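(* Let $\omega_1,\omega_2\in\mathbb C$ with $\omega_1/\omega_2\notin\mathbb R$, let $\Lambda=\{a\omega_1+b\omega_2: a,b\in\mathbb Z\}$, and let $f$ be an elliptic function on $\Lambda$. Then the sum of the residues of $f$ in a fundamental parallelogram is zero.
   Context: Given $\omega_1,\omega_2\in\mathbb C$ with $\omega_1/\omega_2\notin\mathbb R$, a meromorphic function $f$ on $\mathbb C$ is called an elliptic function (on the lattice $\Lambda$ generated by $\omega_1,\omega_2$) if $f(z+\omega_1)=f(z+\omega_2)=f(z)$ for all $z\in\mathbb C$. The fundamental parallelogram is the parallelogram in $\mathbb C$ with vertices $0$, $\omega_1$, $\omega_2$, and $\omega_1+\omega_2$. *)

(* Defs.v *)
(* Library world: Stdlib reals with Coquelicot's complex numbers. *)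
From Stdlib Require Import Reals List.
From Coquelicot Require Import Coquelicot.
Open Scope C_scope.

(* Functions with values in the Riemann sphere are encoded as [C -> option C],
   [None] standing for the point at infinity. *)

Definition holomorphic_near (g : C -> C) (a : C) : Prop :=
  locally a (fun z => ex_derive (K := C_AbsRing) (V := C_NormedModule) g z).

Definition regular_at (f : C -> option C) (a : C) : Prop :=
  exists g : C -> C,
    holomorphic_near g a /\ locally a (fun z => f z = Some (g z)).

(* [m] is the order of the pole. *)
Definition pole_at (f : C -> option C) (a : C) : Prop :=
  f a = None /\
  exists (m : nat) (h : C -> C),
    (0 < m)%nat /\ holomorphic_near h a /\ h a <> 0 /\
    locally' a (fun z => f z = Some (h z / (z - a) ^ m)).

Definition meromorphic (f : C -> option C) : Prop :=
  forall a : C, regular_at f a \/ pole_at f a.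

(* Near [a], [f] is its principal part
   c_0 / (z - a) + c_1 / (z - a)^2 + ... + c_n / (z - a)^(n+1)
   plus a holomorphic function; the residue is the coefficient of 1 / (z - a),
   which is [c 0] because the indices are shifted by one. *)
Definition is_residue (f : C -> option C) (a r : C) : Prop :=
  exists (n : nat) (c : nat -> C) (g : C -> C),
    holomorphic_near g a /\
    locally' a (fun z =>
      f z = Some (sum_n (fun k => c k / (z - a) ^ S k) n + g z)) /\
    r = c 0%nat.

(* [iota] selects the unique value satisfying the predicate; the value is
   arbitrary only if [f] is not meromorphic at [a]. *)
Definition residue (f : C -> option C) (a : C) : C :=
  iota (T := C_CompleteNormedModule) (is_residue f a).

(* Equality in [option C]: translation by a period also preserves poles. *)
Definition elliptic (w1 w2 : C) (f : C -> option C) : Prop :=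
  meromorphic f /\ forall z : C, f (z + w1) = f z /\ f (z + w2) = f z.

(* The parallelogram with vertices 0, w1, w2, w1 + w2.  Only the two sides
   through 0 are included, so that it contains exactly one point of each class
   modulo the lattice: with the closed parallelogram, a pole on the boundary
   would be counted several times. *)
Definition fundamental_parallelogram (w1 w2 z : C) : Prop :=
  exists s t : R,
    (0 <= s < 1)%R /\ (0 <= t < 1)%R /\ z = RtoC s * w1 + RtoC t * w2.

Definition Csum (l : list C) : C := fold_right Cplus 0 l.

(* Main.v *)
(* Cauchy's theory is developed on parallelograms with sides parallel to [w1]
   and [w2], described by the coordinates (s, t) of the point s w1 + t w2.
   Goursat's bisection makes boundary integrals of holomorphic functions vanish,
   and Cauchy's formula then splits principal parts off at the poles, so that a
   boundary integral is a nonzero constant times the sum of the residues inside.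
   Over a full period parallelogram the integrals along opposite sides cancel.
   To keep the poles off the boundary, the fundamental parallelogram is
   translated, which replaces each pole by one congruent to it. *)

Require Import Defs.
From Stdlib Require Import Reals List Lra Lia Psatz Classical ClassicalEpsilon.
From Coquelicot Require Import Coquelicot.
Open Scope C_scope.

(** * Complex differentiability *)

(** Since [residue] is given by [iota], its value is known only once residues exist and are unique.
    Existence asks for a finite expansion of a holomorphic [h] at [a]. It is obtained without power
    series, by iterating [h z = h a + (z - a) * h1 z]; the difficulty is that [h1] must again be
    differentiable at [a] itself, and this is where Cauchy's formula is needed. Uniqueness follows
    from the residue theorem, which is therefore proved for an arbitrary choice [res] of admissible
    residues: two candidates at one point give the same boundary integral, a multiple of [wind].
    Hence it suffices that [wind] is nonzero, and the sign of an imaginary part shows this without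
    any logarithm or arctangent. Deformation of contours is replaced by two moves on parallelograms,
    cutting off strips where the function is holomorphic and rescaling a square in coordinates. That
    [w1 / w2] is not real enters as the nonvanishing of the determinant of [w1] and [w2], which
    makes the coordinates well defined and gives all four sides the same sense of rotation about an
    inner point. *)

Lemma im_le_Cmod (z : C) : (Rabs (Im z) <= Cmod z)%R.
Proof. eapply Rle_trans; [|apply Rmax_Cmod]; apply Rmax_r. Qed.

Lemma Im_mult_inv (w z : C) : z <> 0 ->
  Im (w * / z) = ((Im w * Re z - Re w * Im z) / (Re z ^ 2 + Im z ^ 2))%R.
Proof.
intros Hz; assert (Hn : (Re z ^ 2 + Im z ^ 2 <> 0)%R).
{ rewrite <- Cmod2_alt; apply pow_nonzero, Rgt_not_eq, Cmod_gt_0, Hz. }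
destruct w, z; unfold Re, Im in *; simpl in *.
field; intros E; apply Hn; rewrite <- E; ring.
Qed.

Lemma locally_Cmod (a : C) (P : C -> Prop) :
  locally (T := C_UniformSpace) a P <->
  exists d : R, (0 < d)%R /\ forall z : C, (Cmod (z - a) < d)%R -> P z.
Proof.
rewrite locally_C; split.
- intros [d Hd]; exists d; split; [apply cond_pos|].
  intros z Hz; apply Hd; exact Hz.
- intros [d [Hd H]]; exists (mkposreal d Hd); intros z Hz; apply H; exact Hz.
Qed.

Lemma locally'_Cmod (a : C) (P : C -> Prop) :
  locally' (T := C_UniformSpace) a P <->
  exists d : R, (0 < d)%R /\ forall z : C, z <> a -> (Cmod (z - a) < d)%R -> P z.
Proof.
unfold locally', within; rewrite locally_Cmod.
split; intros [d [Hd H]]; exists d; split; auto; intros z; intros; apply H; auto.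
Qed.

(** The difference quotient is multiplied out, so that [w = z] needs no exception and estimates on
    [Cmod] apply directly. *)
Definition cderiv (g : C -> C) (z A : C) : Prop :=
  forall e : R, (0 < e)%R -> exists d : R, (0 < d)%R /\
  forall w : C, (Cmod (w - z) < d)%R ->
    (Cmod (g w - g z - A * (w - z)) <= e * Cmod (w - z))%R.

Definition cdiff (g : C -> C) (z : C) : Prop := exists A, cderiv g z A.

Lemma cdiff_ex_derive (g : C -> C) (z : C) :
  ex_derive (K := C_AbsRing) (V := C_NormedModule) g z <-> cdiff g z.
Proof.
assert (comm : forall u v : C, Cmult u v = Cmult v u) by (intros; ring).
split.
- intros [A [_ HA]]; exists A; intros e He.
  destruct (HA z (fun P H => H) (mkposreal e He)) as [d Hd].
  exists d; split; [apply cond_pos|]; intros w Hw.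
  specialize (Hd w Hw); simpl in Hd.
  rewrite (comm A); exact Hd.
- intros [A HA]; exists A; split.
  { apply (is_linear_scal_l (K := C_AbsRing) (V := C_NormedModule)). }
  intros x Hx.
  assert (x = z) as ->.
  { symmetry; apply (is_filter_lim_locally_unique (K := C_AbsRing)
      (V := AbsRing_NormedModule C_AbsRing)); exact Hx. }
  intros [e He]; destruct (HA e He) as [d [Hd H]].
  exists (mkposreal d Hd); intros w Hw; specialize (H w Hw).
  rewrite (comm A) in H; exact H.
Qed.

Lemma Cmod_sub_sym (a b : C) : Cmod (a - b) = Cmod (b - a).
Proof. rewrite <- Cmod_opp; f_equal; ring. Qed.

Lemma Cmod_triangle_sub (a b c : C) :
  (Cmod (a - c) <= Cmod (a - b) + Cmod (b - c))%R.
Proof.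
replace (a - c) with ((a - b) + (b - c)) by ring; apply Cmod_triangle.
Qed.

Lemma Cmod_sub_gt_0 (a b : C) : a <> b -> (0 < Cmod (a - b))%R.
Proof.
intros H; apply Cmod_gt_0; intros E; apply H.
replace a with ((a - b) + b) by ring; rewrite E; ring.
Qed.

Lemma Csub_neq_0 (a b : C) : a <> b -> a - b <> 0.
Proof. intros H; apply Cmod_gt_0, Cmod_sub_gt_0, H. Qed.

Lemma cderiv_lip (g : C -> C) (z A : C) : cderiv g z A ->
  exists d : R, (0 < d)%R /\ forall w : C, (Cmod (w - z) < d)%R ->
    (Cmod (g w - g z) <= (Cmod A + 1) * Cmod (w - z))%R.
Proof.
intros H; destruct (H 1%R Rlt_0_1) as [d [Hd Hw]]; exists d; split; auto.
intros w Hwd; specialize (Hw w Hwd).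
replace (g w - g z) with ((g w - g z - A * (w - z)) + A * (w - z)) by ring.
eapply Rle_trans; [apply Cmod_triangle|]; rewrite Cmod_mult; lra.
Qed.

Lemma cdiff_cont (g : C -> C) (z : C) : cdiff g z ->
  forall e : R, (0 < e)%R -> exists d : R, (0 < d)%R /\
  forall w : C, (Cmod (w - z) < d)%R -> (Cmod (g w - g z) < e)%R.
Proof.
intros [A HA] e He; destruct (cderiv_lip _ _ _ HA) as [d [Hd H]].
pose proof (Cmod_ge_0 A).
assert (0 < e / (Cmod A + 1))%R by (apply Rdiv_lt_0_compat; lra).
exists (Rmin d (e / (Cmod A + 1))); split; [now apply Rmin_pos|].
intros w Hw.
eapply Rle_lt_trans; [apply H; eapply Rlt_le_trans; [exact Hw|apply Rmin_l]|].
apply Rlt_le_trans with ((Cmod A + 1) * (e / (Cmod A + 1)))%R.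
- apply Rmult_lt_compat_l; [lra|]; eapply Rlt_le_trans; [exact Hw|apply Rmin_r].
- right; field; lra.
Qed.

Lemma cdiff_ext_loc (f g : C -> C) (z : C) (d : R) : (0 < d)%R ->
  (forall w, (Cmod (w - z) < d)%R -> f w = g w) -> cdiff f z -> cdiff g z.
Proof.
intros Hd E [A HA]; exists A; intros e He.
destruct (HA e He) as [d' [Hd' H]]; exists (Rmin d d'); split; [now apply Rmin_pos|].
intros w Hw.
rewrite <- !E.
- apply H; eapply Rlt_le_trans; [exact Hw|apply Rmin_r].
- replace (z - z) with (RtoC 0) by ring; rewrite Cmod_0; auto.
- eapply Rlt_le_trans; [exact Hw|apply Rmin_l].
Qed.

Lemma cdiff_ext (f g : C -> C) (z : C) :
  (forall w, f w = g w) -> cdiff f z -> cdiff g z.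
Proof. intros E; apply cdiff_ext_loc with 1%R; auto; lra. Qed.

Lemma cdiff_const (c z : C) : cdiff (fun _ => c) z.
Proof.
exists 0; intros e He; exists 1%R; split; [lra|]; intros w _.
replace (c - c - 0 * (w - z)) with (RtoC 0) by ring; rewrite Cmod_0.
apply Rmult_le_pos; [lra|apply Cmod_ge_0].
Qed.

Lemma cdiff_id (z : C) : cdiff (fun w => w) z.
Proof.
exists 1; intros e He; exists 1%R; split; [lra|]; intros w _.
replace (w - z - 1 * (w - z)) with (RtoC 0) by ring; rewrite Cmod_0.
apply Rmult_le_pos; [lra|apply Cmod_ge_0].
Qed.

Lemma cdiff_plus (f g : C -> C) (z : C) :
  cdiff f z -> cdiff g z -> cdiff (fun w => f w + g w) z.
Proof.
intros [A HA] [B HB]; exists (A + B); intros e He.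
destruct (HA (e / 2)%R) as [d1 [Hd1 H1]]; [lra|].
destruct (HB (e / 2)%R) as [d2 [Hd2 H2]]; [lra|].
exists (Rmin d1 d2); split; [now apply Rmin_pos|]; intros w Hw.
specialize (H1 w (Rlt_le_trans _ _ _ Hw (Rmin_l _ _))).
specialize (H2 w (Rlt_le_trans _ _ _ Hw (Rmin_r _ _))).
replace (_ - _ - _) with ((f w - f z - A * (w - z)) + (g w - g z - B * (w - z))) by ring.
eapply Rle_trans; [apply Cmod_triangle|lra].
Qed.

Lemma cdiff_mult (f g : C -> C) (z : C) :
  cdiff f z -> cdiff g z -> cdiff (fun w => f w * g w) z.
Proof.
intros [A HA] [B HB]; exists (A * g z + f z * B); intros e He.
pose proof (Cmod_ge_0 A) as PA; pose proof (Cmod_ge_0 B) as PB.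
pose proof (Cmod_ge_0 (f z)) as Pf; pose proof (Cmod_ge_0 (g z)) as Pg.
destruct (cderiv_lip _ _ _ HB) as [d0 [Hd0 H0]].
(* The error splits into three terms, each allotted a third of [e]. The constant in [e1] bounds
   [Cmod (g w)] when [w] is within 1 of [z]; [d3] controls the product of the two increments. *)
set (e1 := (e / (3 * (Cmod (g z) + Cmod B + 1)))%R).
set (e2 := (e / (3 * (Cmod (f z) + 1)))%R).
set (d3 := (e / (3 * (Cmod A + 1) * (Cmod B + 1)))%R).
assert (Pe1 : (0 < e1)%R) by (apply Rdiv_lt_0_compat; lra).
assert (Pe2 : (0 < e2)%R) by (apply Rdiv_lt_0_compat; lra).
assert (Pd3 : (0 < d3)%R) by (apply Rdiv_lt_0_compat; nra).
destruct (HA e1) as [d1 [Hd1 H1]]; auto.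
destruct (HB e2) as [d2 [Hd2 H2]]; auto.
exists (Rmin (Rmin 1 d0) (Rmin (Rmin d1 d2) d3)); split.
{ repeat apply Rmin_pos; auto; lra. }
intros w Hw.
apply Rmin_Rgt in Hw as [Hw Hw']; apply Rmin_Rgt in Hw as [Hw1 Hw0].
apply Rmin_Rgt in Hw' as [Hw' Hw3]; apply Rmin_Rgt in Hw' as [Hwd1 Hwd2].
specialize (H0 w Hw0); specialize (H1 w Hwd1); specialize (H2 w Hwd2).
set (x := Cmod (w - z)) in *.
assert (Px : (0 <= x)%R) by apply Cmod_ge_0.
replace (_ - _ - _) with ((f w - f z - A * (w - z)) * g w
  + (f z * (g w - g z - B * (w - z)) + A * (w - z) * (g w - g z))) by ring.
eapply Rle_trans; [apply Cmod_triangle|].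
eapply Rle_trans; [apply Rplus_le_compat_l, Cmod_triangle|].
rewrite !Cmod_mult; fold x.
assert (Hg : (Cmod (g w) <= Cmod (g z) + Cmod B + 1)%R).
{ replace (g w) with (g z + (g w - g z)) by ring.
  eapply Rle_trans; [apply Cmod_triangle|]; nra. }
assert (E1 : (Cmod (f w - f z - A * (w - z)) * Cmod (g w) <= e / 3 * x)%R).
{ apply Rle_trans with (e1 * x * (Cmod (g z) + Cmod B + 1))%R.
  - apply Rmult_le_compat; auto using Cmod_ge_0.
  - right; unfold e1; field; lra. }
assert (E2 : (Cmod (f z) * Cmod (g w - g z - B * (w - z)) <= e / 3 * x)%R).
{ apply Rle_trans with ((Cmod (f z) + 1) * (e2 * x))%R.
  - apply Rmult_le_compat; auto using Cmod_ge_0; lra.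
  - right; unfold e2; field; lra. }
assert (E3 : (Cmod A * x * Cmod (g w - g z) <= e / 3 * x)%R).
{ apply Rle_trans with ((Cmod A + 1) * x * ((Cmod B + 1) * d3))%R.
  - apply Rmult_le_compat; auto using Cmod_ge_0; [nra|nra|].
    eapply Rle_trans; [exact H0|]; apply Rmult_le_compat_l; lra.
  - right; unfold d3; field; lra. }
lra.
Qed.

Lemma cdiff_inv (z : C) : z <> 0 -> cdiff (fun w => / w) z.
Proof.
intros Hz; exists (- / (z * z)); intros e He.
assert (Pz : (0 < Cmod z)%R) by now apply Cmod_gt_0.
(* The error is exactly [(w - z)^2 / (z^2 w)], and [w] has modulus above half that of [z]; [d2]
   makes the quotient at most [e * Cmod (w - z)]. *)
set (d2 := (e * Cmod z * Cmod z * Cmod z / 2)%R).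
assert (0 < d2)%R by (unfold d2; apply Rdiv_lt_0_compat; [repeat apply Rmult_lt_0_compat; lra|lra]).
exists (Rmin (Cmod z / 2) d2); split; [apply Rmin_pos; lra|].
intros w Hw; apply Rmin_Rgt in Hw as [Hw1 Hw2].
assert (Hm : (Cmod z / 2 < Cmod w)%R).
{ assert (Cmod z <= Cmod (w - z) + Cmod w)%R; [|lra].
  rewrite (Cmod_sub_sym w z).
  replace (Cmod z) with (Cmod ((z - w) + w)) by (f_equal; ring); apply Cmod_triangle. }
assert (Hw0 : w <> 0) by (apply Cmod_gt_0; lra).
replace (_ - _ - _) with ((w - z) * (w - z) / (z * z * w)) by (field; auto).
rewrite Cmod_div, !Cmod_mult by (repeat apply Cmult_neq_0; auto).
set (x := Cmod (w - z)) in *; assert (0 <= x)%R by apply Cmod_ge_0.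
assert (Pd : (0 < Cmod z * Cmod z * Cmod w)%R) by (repeat apply Rmult_lt_0_compat; lra).
apply Rmult_le_reg_r with (1 := Pd).
replace (x * x / (Cmod z * Cmod z * Cmod w) * (Cmod z * Cmod z * Cmod w))%R
  with (x * x)%R by (field; lra).
replace (e * x * (Cmod z * Cmod z * Cmod w))%R with (x * (e * (Cmod z * Cmod z * Cmod w)))%R by ring.
apply Rmult_le_compat_l; auto.
apply Rle_trans with d2; [lra|]; unfold d2.
replace (e * Cmod z * Cmod z * Cmod z / 2)%R with (e * (Cmod z * Cmod z * (Cmod z / 2)))%R by field.
apply Rmult_le_compat_l; [lra|]; apply Rmult_le_compat_l; [nra|lra].
Qed.

Lemma cdiff_comp (f g : C -> C) (z : C) :
  cdiff g z -> cdiff f (g z) -> cdiff (fun w => f (g w)) z.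
Proof.
intros [B HB] [A HA]; exists (A * B); intros e He.
pose proof (Cmod_ge_0 A) as PA; pose proof (Cmod_ge_0 B) as PB.
destruct (cderiv_lip _ _ _ HB) as [d0 [Hd0 H0]].
set (e1 := (e / (2 * (Cmod B + 1)))%R).
set (e2 := (e / (2 * (Cmod A + 1)))%R).
assert (Pe1 : (0 < e1)%R) by (apply Rdiv_lt_0_compat; lra).
assert (Pe2 : (0 < e2)%R) by (apply Rdiv_lt_0_compat; lra).
destruct (HA e1 Pe1) as [d1 [Hd1 H1]].
destruct (HB e2 Pe2) as [d2 [Hd2 H2]].
destruct (cdiff_cont g z (ex_intro _ B HB) d1 Hd1) as [d3 [Hd3 H3]].
exists (Rmin d0 (Rmin d2 d3)); split; [repeat apply Rmin_pos; auto|].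
intros w Hw; apply Rmin_Rgt in Hw as [Hw0 Hw]; apply Rmin_Rgt in Hw as [Hw2 Hw3].
specialize (H0 w Hw0); specialize (H1 _ (H3 w Hw3)); specialize (H2 w Hw2).
set (x := Cmod (w - z)) in *.
assert (Px : (0 <= x)%R) by apply Cmod_ge_0.
replace (_ - _ - _) with ((f (g w) - f (g z) - A * (g w - g z))
  + A * (g w - g z - B * (w - z))) by ring.
eapply Rle_trans; [apply Cmod_triangle|]; rewrite Cmod_mult.
assert (E1 : (e1 * Cmod (g w - g z) <= e / 2 * x)%R).
{ apply Rle_trans with (e1 * ((Cmod B + 1) * x))%R.
  - apply Rmult_le_compat_l; lra.
  - right; unfold e1; field; lra. }
assert (E2 : (Cmod A * Cmod (g w - g z - B * (w - z)) <= e / 2 * x)%R).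
{ apply Rle_trans with ((Cmod A + 1) * (e2 * x))%R.
  - apply Rmult_le_compat; auto using Cmod_ge_0; lra.
  - right; unfold e2; field; lra. }
lra.
Qed.

Lemma cdiff_scal (c : C) (g : C -> C) (z : C) :
  cdiff g z -> cdiff (fun w => c * g w) z.
Proof. apply cdiff_mult, cdiff_const. Qed.

Lemma cdiff_sub_const (a z : C) : cdiff (fun w => w - a) z.
Proof. apply cdiff_plus; [apply cdiff_id|apply cdiff_const]. Qed.

Lemma cdiff_pow (g : C -> C) (n : nat) (z : C) :
  cdiff g z -> cdiff (fun w => g w ^ n) z.
Proof.
intros H; induction n as [|n IH]; simpl; [apply cdiff_const|now apply cdiff_mult].
Qed.

Lemma cdiff_div (f g : C -> C) (z : C) :
  cdiff f z -> cdiff g z -> g z <> 0 -> cdiff (fun w => f w / g w) z.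
Proof.
intros Hf Hg H0; apply cdiff_mult; auto.
apply (cdiff_comp (fun w => / w)); auto; now apply cdiff_inv.
Qed.

Lemma cdiff_minus (f g : C -> C) (z : C) :
  cdiff f z -> cdiff g z -> cdiff (fun w => f w - g w) z.
Proof.
intros Hf Hg; apply cdiff_ext with (fun w => f w + (- (1)) * g w).
- intros; ring.
- apply cdiff_plus; auto; now apply cdiff_scal.
Qed.

Lemma cdiff_inv_pow (a : C) (k : nat) (z : C) : z <> a -> cdiff (fun x => / (x - a) ^ k) z.
Proof.
intros Hz; apply (cdiff_comp (fun x => / x)).
- apply cdiff_pow, cdiff_sub_const.
- apply cdiff_inv, Cpow_nz, Csub_neq_0, Hz.
Qed.

Definition cdiff_near (g : C -> C) (a : C) : Prop :=
  exists d : R, (0 < d)%R /\ forall z, (Cmod (z - a) < d)%R -> cdiff g z.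

(** * Integrals of complex-valued functions of a real variable *)

Definition ex_CInt (g : R -> C) (a b : R) : Prop :=
  ex_RInt (V := C_R_NormedModule) g a b.

Definition CInt (g : R -> C) (a b : R) : C :=
  RInt (V := C_R_CompleteNormedModule) g a b.

Lemma ex_CInt_cont (g : R -> C) (a b : R) : (a <= b)%R ->
  (forall x, (a <= x <= b)%R -> forall e, (0 < e)%R -> exists d, (0 < d)%R /\
     forall y, (Rabs (y - x) < d)%R -> (Cmod (g y - g x) < e)%R) ->
  ex_CInt g a b.
Proof.
intros Hab H; apply (ex_RInt_continuous (V := C_R_CompleteNormedModule)).
rewrite Rmin_left, Rmax_right by auto; intros x Hx.
apply filterlim_locally; intros [e He].
destruct (H x Hx e He) as [d [Hd Hy]]; exists (mkposreal d Hd); intros y Hyx.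
apply C_NormedModule_mixin_compat1, Hy, Hyx.
Qed.

Lemma CInt_plus (f g : R -> C) (a b : R) : ex_CInt f a b -> ex_CInt g a b ->
  CInt (fun x => f x + g x) a b = CInt f a b + CInt g a b.
Proof. intros; apply (RInt_plus (V := C_R_CompleteNormedModule)); auto. Qed.

(** Integrals are taken in [C] as a real normed space, whose linearity covers real scalars only; a
    complex factor is treated through real and imaginary parts. *)
Lemma is_CInt_scal (c : C) (f : R -> C) (a b : R) (l : C) :
  is_RInt (V := C_R_NormedModule) f a b l ->
  is_RInt (V := C_R_NormedModule) (fun x => c * f x) a b (c * l).
Proof.
intros H.
assert (H1 := is_RInt_fct_extend_fst (U := R_NormedModule) (V := R_NormedModule) _ _ _ _ H).
assert (H2 := is_RInt_fct_extend_snd (U := R_NormedModule) (V := R_NormedModule) _ _ _ _ H).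
apply (is_RInt_fct_extend_pair (U := R_NormedModule) (V := R_NormedModule)).
- apply (is_RInt_minus (V := R_NormedModule)
    (fun x => fst c * fst (f x))%R (fun x => snd c * snd (f x))%R);
  apply (is_RInt_scal (V := R_NormedModule)); auto.
- apply (is_RInt_plus (V := R_NormedModule)
    (fun x => fst c * snd (f x))%R (fun x => snd c * fst (f x))%R);
  apply (is_RInt_scal (V := R_NormedModule)); auto.
Qed.

Lemma CInt_correct (f : R -> C) (a b : R) : ex_CInt f a b ->
  is_RInt (V := C_R_NormedModule) f a b (CInt f a b).
Proof. apply (RInt_correct (V := C_R_CompleteNormedModule)). Qed.

Lemma CInt_unique (f : R -> C) (a b : R) (l : C) :
  is_RInt (V := C_R_NormedModule) f a b l -> CInt f a b = l.
Proof. apply (is_RInt_unique (V := C_R_CompleteNormedModule)). Qed.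

Lemma CInt_scal (c : C) (f : R -> C) (a b : R) : ex_CInt f a b ->
  CInt (fun x => c * f x) a b = c * CInt f a b.
Proof. intros H; apply CInt_unique, is_CInt_scal, CInt_correct, H. Qed.

Lemma CInt_const (c : C) (a b : R) : CInt (fun _ => c) a b = RtoC (b - a) * c.
Proof.
apply CInt_unique; replace (RtoC (b - a) * c) with (@scal _ C_R_NormedModule (b - a)%R c).
- apply (is_RInt_const (V := C_R_NormedModule)).
- destruct c; unfold scal; simpl; unfold prod_scal, Cmult; simpl.
  unfold scal; simpl; unfold mult; simpl; f_equal; ring.
Qed.

Lemma CInt_Chasles (f : R -> C) (a b c : R) : ex_CInt f a b -> ex_CInt f b c ->
  CInt f a c = CInt f a b + CInt f b c.
Proof. intros; symmetry; apply (RInt_Chasles (V := C_R_CompleteNormedModule)); auto. Qed.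

Lemma CInt_ext (f g : R -> C) (a b : R) : (a <= b)%R ->
  (forall x, (a <= x <= b)%R -> f x = g x) -> CInt f a b = CInt g a b.
Proof.
intros Hab H; apply (RInt_ext (V := C_R_CompleteNormedModule)).
rewrite Rmin_left, Rmax_right by auto; intros x Hx; apply H; lra.
Qed.

Lemma CInt_bound (f : R -> C) (a b M : R) : (a <= b)%R -> ex_CInt f a b ->
  (forall x, (a <= x <= b)%R -> (Cmod (f x) <= M)%R) ->
  (Cmod (CInt f a b) <= (b - a) * M)%R.
Proof.
intros Hab Hf HM; rewrite Cmod_norm.
apply (norm_RInt_le_const (V := C_R_NormedModule) f a b); auto.
- intros x Hx; specialize (HM x Hx); rewrite Cmod_norm in HM; exact HM.
- apply CInt_correct, Hf.
Qed.

Lemma CInt_affine (f : R -> C) (u v a b : R) : ex_CInt f (u * a + v) (u * b + v) ->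
  CInt f (u * a + v) (u * b + v) = CInt (fun x => RtoC u * f (u * x + v)%R) a b.
Proof.
intros H; unfold CInt.
rewrite <- (RInt_comp_lin (V := C_R_CompleteNormedModule) f u v a b H).
apply (RInt_ext (V := C_R_CompleteNormedModule)); intros x _.
destruct (f (u * x + v)%R); unfold scal; simpl; unfold prod_scal, Cmult; simpl.
unfold scal; simpl; unfold mult; simpl; f_equal; ring.
Qed.

Lemma Im_CInt (f : R -> C) (a b : R) : ex_CInt f a b ->
  is_RInt (fun x => Im (f x)) a b (Im (CInt f a b)).
Proof.
intros H; apply (is_RInt_fct_extend_snd (U := R_NormedModule) (V := R_NormedModule)).
apply CInt_correct, H.
Qed.

Lemma bounded_segment (f : R -> C) (a b : R) :
  (forall x, (a <= x <= b)%R -> forall e, (0 < e)%R -> exists d, (0 < d)%R /\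
     forall y, (Rabs (y - x) < d)%R -> (Cmod (f y - f x) < e)%R) ->
  exists M, forall x, (a <= x <= b)%R -> (Cmod (f x) <= M)%R.
Proof.
intros H.
destruct (bounded_continuity (V := C_R_NormedModule) f a b) as [M HM].
- intros x Hx; apply filterlim_locally; intros [e He].
  destruct (H x Hx e He) as [d [Hd Hy]]; exists (mkposreal d Hd); intros y Hyx.
  apply C_NormedModule_mixin_compat1, Hy, Hyx.
- exists M; intros x Hx; rewrite Cmod_norm; left; exact (HM x Hx).
Qed.

(** * Principal parts and residues *)

Definition principal (c : nat -> C) (a : C) (n : nat) (z : C) : C :=
  sum_n (fun k => c k / (z - a) ^ S k) n.

(** The analogue of [is_residue] for functions with values in [C], which are the ones that can be
    integrated and modified by subtracting principal parts. *)
Definition residue_at (f : C -> C) (a r : C) : Prop :=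
  exists (n : nat) (c : nat -> C) (g : C -> C) (d : R), (0 < d)%R /\ cdiff_near g a /\
    (forall z, z <> a -> (Cmod (z - a) < d)%R -> f z = principal c a n z + g z) /\
    r = c 0%nat.

Lemma cdiff_principal (c : nat -> C) (a : C) (n : nat) (z : C) : z <> a ->
  cdiff (principal c a n) z.
Proof.
intros Hz.
assert (H : forall k, cdiff (fun x => c k / (x - a) ^ S k) z).
{ intros k; apply cdiff_scal, (cdiff_inv_pow a (S k)), Hz. }
induction n as [|n IH].
- apply cdiff_ext with (fun x => c O / (x - a) ^ 1); auto.
  intros x; unfold principal; now rewrite sum_O.
- apply cdiff_ext with (fun x => principal c a n x + c (S n) / (x - a) ^ S (S n)).
  + intros x; unfold principal; now rewrite sum_Sn.
  + apply cdiff_plus; auto.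
Qed.

Lemma cdiff_near_cdiff (g : C -> C) (a : C) : cdiff_near g a -> cdiff g a.
Proof.
intros [d [Hd H]]; apply H; replace (a - a) with (RtoC 0) by ring; now rewrite Cmod_0.
Qed.

Lemma cdiff_near_minus_principal (g : C -> C) (c : nat -> C) (a b : C) (n : nat) :
  b <> a -> cdiff_near g b -> cdiff_near (fun z => g z - principal c a n z) b.
Proof.
intros Hb [d [Hd Hg]]; assert (P := Cmod_sub_gt_0 _ _ Hb).
exists (Rmin d (Cmod (b - a))); split; [now apply Rmin_pos|].
intros z Hz; apply Rmin_Rgt in Hz as [Hz1 Hz2]; apply cdiff_minus; auto.
apply cdiff_principal; intros ->; rewrite Cmod_sub_sym in Hz2; lra.
Qed.

Lemma residue_at_cdiff (f : C -> C) (a r : C) : residue_at f a r ->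
  exists d : R, (0 < d)%R /\ forall z, z <> a -> (Cmod (z - a) < d)%R -> cdiff f z.
Proof.
intros (n & c & g & d & Hd & [d' [Hd' Hg]] & E & _).
exists (Rmin d d'); split; [now apply Rmin_pos|].
intros z Hz Hzd; apply Rmin_Rgt in Hzd as [Hz1 Hz2].
assert (P := Cmod_sub_gt_0 _ _ Hz).
(* This radius keeps the disc around [z] away from [a] and inside the disc where the decomposition
   holds. *)
apply cdiff_ext_loc with (fun x => principal c a n x + g x) (Rmin (Cmod (z - a)) (d - Cmod (z - a))).
- apply Rmin_pos; lra.
- intros x Hx; apply Rmin_Rgt in Hx as [Hx1 Hx2]; symmetry; apply E.
  + intros ->; rewrite Cmod_sub_sym in Hx1; lra.
  + pose proof (Cmod_triangle_sub x z a); lra.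
- apply cdiff_plus; auto; now apply cdiff_principal.
Qed.

(** The default 0 at poles respects periodicity, and it is never met on a contour because the poles
    lie off the boundaries. *)
Definition finite_value (f : C -> option C) (z : C) : C :=
  match f z with Some v => v | None => 0 end.

Lemma is_residue_residue_at (f : C -> option C) (a r : C) :
  is_residue f a r -> residue_at (finite_value f) a r.
Proof.
intros (n & c & g & Hg & Hf & Er).
apply locally_Cmod in Hg as [d [Hd Hg]]; apply locally'_Cmod in Hf as [d' [Hd' Hf]].
exists n, c, g, d'; split; [auto|split; [|split; auto]].
- exists d; split; auto; intros z Hz; apply cdiff_ex_derive, Hg, Hz.
- intros z Hz Hzd; unfold finite_value; now rewrite Hf.
Qed.

Lemma cdiff_near_translate (g : C -> C) (a w : C) :
  cdiff_near g a -> cdiff_near (fun z => g (z - w)) (a + w).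
Proof.
intros [d [Hd H]]; exists d; split; auto; intros z Hz.
apply (cdiff_comp g); [apply cdiff_sub_const|apply H].
replace (z - w - a) with (z - (a + w)) by ring; auto.
Qed.

Lemma is_residue_translate (f : C -> option C) (w a r : C) :
  (forall z, f (z + w) = f z) -> is_residue f a r -> is_residue f (a + w) r.
Proof.
intros Hp (n & c & g & Hg & Hf & Er).
apply locally_Cmod in Hg as [d [Hd Hg]]; apply locally'_Cmod in Hf as [d' [Hd' Hf]].
exists n, c, (fun z => g (z - w)); split; [|split; auto].
- assert (Hn : cdiff_near g a).
  { exists d; split; auto; intros z Hz; apply cdiff_ex_derive, Hg, Hz. }
  apply (cdiff_near_translate g a w) in Hn as [e [He Hn]].
  apply locally_Cmod; exists e; split; auto; intros z Hz; apply cdiff_ex_derive, Hn, Hz.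
- apply locally'_Cmod; exists d'; split; auto; intros z Hz Hzd.
  assert (E : z - w - a = z - (a + w)) by ring.
  replace (f z) with (f (z - w)) by (rewrite <- Hp; f_equal; ring).
  rewrite Hf.
  + now rewrite E.
  + intros Ea; apply Hz; rewrite <- Ea; ring.
  + now rewrite E.
Qed.

Lemma meromorphic_poles_isolated (f : C -> option C) (a : C) : meromorphic f ->
  exists d : R, (0 < d)%R /\ forall z, z <> a -> (Cmod (z - a) < d)%R -> f z <> None.
Proof.
intros Hm; destruct (Hm a) as [(g & _ & Hf)|(_ & m & h & _ & _ & _ & Hf)].
- apply locally_Cmod in Hf as [d [Hd Hf]]; exists d; split; auto.
  intros z _ Hz; rewrite Hf; auto; discriminate.
- apply locally'_Cmod in Hf as [d [Hd Hf]]; exists d; split; auto.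
  intros z Hz Hzd; rewrite Hf; auto; discriminate.
Qed.

Lemma meromorphic_None (f : C -> option C) (z : C) : meromorphic f ->
  f z = None -> pole_at f z.
Proof.
intros Hm Hz; destruct (Hm z) as [(g & _ & Hf)|H]; auto.
apply locally_Cmod in Hf as [d [Hd Hf]]; rewrite Hf in Hz; [discriminate|].
replace (z - z) with (RtoC 0) by ring; now rewrite Cmod_0.
Qed.

Lemma meromorphic_cdiff (f : C -> option C) (z : C) : meromorphic f ->
  f z <> None -> cdiff (finite_value f) z.
Proof.
intros Hm Hz; destruct (Hm z) as [(g & Hg & Hf)|[H _]]; [|tauto].
apply locally_Cmod in Hf as [d [Hd Hf]]; apply locally_Cmod in Hg as [d' [Hd' Hg]].
apply cdiff_ext_loc with g d; auto.
- intros w Hw; unfold finite_value; now rewrite Hf.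
- apply cdiff_ex_derive, Hg; replace (z - z) with (RtoC 0) by ring; now rewrite Cmod_0.
Qed.

(** * Bisection and finite sets *)

(** A rectangle where [P] fails has a quarter where it fails; the nested failing quarters close in
    on a point, and the hypothesis near that point is contradicted. This form of compactness serves
    both for Goursat's estimate and for the finiteness of the set of poles. *)
Lemma rectangle_bisection (P : R -> R -> R -> R -> Prop) (a0 b0 c0 d0 : R) :
  (a0 <= b0)%R -> (c0 <= d0)%R ->
  (forall a b c d, let m := ((a + b) / 2)%R in let n := ((c + d) / 2)%R in
     (a <= b)%R -> (c <= d)%R ->
     (a0 <= a)%R -> (b <= b0)%R -> (c0 <= c)%R -> (d <= d0)%R ->
     P a m c n -> P m b c n -> P a m n d -> P m b n d -> P a b c d) ->
  (forall s t, (a0 <= s <= b0)%R -> (c0 <= t <= d0)%R ->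
     exists e, (0 < e)%R /\ forall a b c d,
       (a0 <= a)%R -> (a <= s <= b)%R -> (b <= b0)%R ->
       (c0 <= c)%R -> (c <= t <= d)%R -> (d <= d0)%R ->
       (b - a < e)%R -> (d - c < e)%R -> P a b c d) ->
  P a0 b0 c0 d0.
Proof.
intros Hab Hcd Hsplit Hloc; apply NNPP; intros HN.
set (inv := fun (n : nat) (q : R * R * R * R) => let '(a, b, c, d) := q in
  (b = a + (b0 - a0) / 2 ^ n)%R /\ (d = c + (d0 - c0) / 2 ^ n)%R /\
  (a0 <= a)%R /\ (b <= b0)%R /\ (c0 <= c)%R /\ (d <= d0)%R /\ ~ P a b c d).
set (sub := fun q' q : R * R * R * R =>
  let '(a, b, c, d) := q in let '(a', b', c', d') := q' in
  (a <= a')%R /\ (b' <= b)%R /\ (c <= c')%R /\ (d' <= d)%R).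
(* The invariant stands under the existential quantifier, so that a successor can be chosen for
   every quadruple without carrying a proof along. *)
assert (Hstep : forall n q, exists q', inv n q -> inv (S n) q' /\ sub q' q).
{ intros n [[[a b] c] d].
  destruct (classic (inv n (a, b, c, d))) as [H|H]; [|exists (a, b, c, d); tauto].
  destruct H as (Eb & Ed & Ha & Hb & Hc & Hd & HP).
  assert (P2 : (0 < 2 ^ n)%R) by (apply pow_lt; lra).
  assert (W1 : (0 <= (b0 - a0) / 2 ^ n)%R) by (apply Rdiv_le_0_compat; lra).
  assert (W2 : (0 <= (d0 - c0) / 2 ^ n)%R) by (apply Rdiv_le_0_compat; lra).
  assert (V1 : ((b0 - a0) / 2 ^ S n = (b0 - a0) / 2 ^ n / 2)%R) by (simpl; field; lra).
  assert (V2 : ((d0 - c0) / 2 ^ S n = (d0 - c0) / 2 ^ n / 2)%R) by (simpl; field; lra).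
  assert (Sp := Hsplit a b c d); cbv zeta in Sp.
  set (m := ((a + b) / 2)%R) in *; set (k := ((c + d) / 2)%R) in *.
  assert (Hm : m = ((a + b) / 2)%R) by reflexivity.
  assert (Hk : k = ((c + d) / 2)%R) by reflexivity.
  clearbody m k.
  destruct (classic (P a m c k)) as [Q1|Q1].
  2:{ exists (a, m, c, k); intros _; unfold inv, sub; rewrite V1, V2.
      repeat split; try lra; auto. }
  destruct (classic (P m b c k)) as [Q2|Q2].
  2:{ exists (m, b, c, k); intros _; unfold inv, sub; rewrite V1, V2.
      repeat split; try lra; auto. }
  destruct (classic (P a m k d)) as [Q3|Q3].
  2:{ exists (a, m, k, d); intros _; unfold inv, sub; rewrite V1, V2.
      repeat split; try lra; auto. }
  destruct (classic (P m b k d)) as [Q4|Q4].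
  2:{ exists (m, b, k, d); intros _; unfold inv, sub; rewrite V1, V2.
      repeat split; try lra; auto. }
  exfalso; apply HP, Sp; auto; lra. }
set (next := fun n q => proj1_sig (constructive_indefinite_description _ (Hstep n q))).
assert (Hnext : forall n q, inv n q -> inv (S n) (next n q) /\ sub (next n q) q).
{ intros n q; unfold next; destruct (constructive_indefinite_description _ _); auto. }
set (Q := fix Q n := match n with O => (a0, b0, c0, d0) | S m => next m (Q m) end).
assert (HQ : forall n, inv n (Q n)).
{ induction n as [|n IH]; [|exact (proj1 (Hnext n _ IH))].
  simpl; repeat split; auto; try lra; field. }
assert (Hsub : forall n k, sub (Q (n + k)%nat) (Q n)).
{ intros n k; induction k as [|k IH].
  - rewrite Nat.add_0_r; destruct (Q n) as [[[a b] c] d]; unfold sub; lra.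
  - rewrite Nat.add_succ_r.
    assert (Hs := proj2 (Hnext (n + k)%nat _ (HQ (n + k)%nat))).
    change (next (n + k)%nat (Q (n + k)%nat)) with (Q (S (n + k))) in Hs.
    destruct (Q (S (n + k))) as [[[a b] c] d], (Q (n + k)%nat) as [[[a' b'] c'] d'],
      (Q n) as [[[a'' b''] c''] d'']; unfold sub in *; lra. }
set (lo1 := fun n => fst (fst (fst (Q n)))).
set (lo2 := fun n => snd (fst (Q n))).
set (hi1 := fun n => snd (fst (fst (Q n)))).
set (hi2 := fun n => snd (Q n)).
assert (Hle : forall n m, (lo1 n <= hi1 m)%R /\ (lo2 n <= hi2 m)%R).
{ intros n m; unfold lo1, lo2, hi1, hi2.
  assert (S1 := Hsub n m); assert (S2 := Hsub m n).
  rewrite Nat.add_comm in S2; assert (I := HQ (n + m)%nat).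
  destruct (Q (n + m)%nat) as [[[a b] c] d], (Q n) as [[[a' b'] c'] d'],
      (Q m) as [[[a'' b''] c''] d'']; unfold sub, inv in *; simpl.
  assert (P2 : (0 < 2 ^ (n + m))%R) by (apply pow_lt; lra).
  assert (W1 : (0 <= (b0 - a0) / 2 ^ (n + m))%R) by (apply Rdiv_le_0_compat; lra).
  assert (W2 : (0 <= (d0 - c0) / 2 ^ (n + m))%R) by (apply Rdiv_le_0_compat; lra).
  lra. }
(* The supremum of the lower ends lies in every interval, since each lower end is below each upper
   end. *)
assert (lim : forall lo hi : nat -> R, (forall n m, (lo n <= hi m)%R) ->
  exists x, forall n, (lo n <= x <= hi n)%R).
{ intros lo hi H; destruct (completeness (fun y => exists n, y = lo n)) as [x [U L]].
  - exists (hi O); intros y [n ->]; apply H.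
  - exists (lo O), O; auto.
  - exists x; intros n; split; [apply U; now exists n|].
    apply L; intros y [k ->]; apply H. }
destruct (lim lo1 hi1) as [s Hs]; [intros; apply Hle|].
destruct (lim lo2 hi2) as [t Ht]; [intros; apply Hle|].
destruct (Hloc s t) as [e [He H]]; [exact (Hs O)|exact (Ht O)|].
(* [w] exceeds both side lengths and is positive even for a degenerate rectangle, so halving until
   [2 ^ N] exceeds [w / e] makes both sides shorter than [e]. *)
set (w := (b0 - a0 + (d0 - c0) + 1)%R).
destruct (pow_lt_1_zero (/ 2) ltac:(rewrite Rabs_right; lra) (e / w)) as [N HN'].
{ apply Rdiv_lt_0_compat; unfold w; lra. }
specialize (HN' N (le_n N)).
assert (I := HQ N); specialize (Hs N); specialize (Ht N).
unfold lo1, hi1, lo2, hi2 in Hs, Ht.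
destruct (Q N) as [[[a b] c] d]; simpl in Hs, Ht, I.
destruct I as (Eb & Ed & Ha & Hb & Hc & Hd & HP); apply HP, H; auto.
- assert (P2 : (0 < / 2 ^ N)%R) by (apply Rinv_0_lt_compat, pow_lt; lra).
  rewrite Rabs_right, pow_inv in HN' by (rewrite pow_inv; lra).
  apply Rmult_lt_compat_r with (r := w) in HN'; [|unfold w; lra].
  replace (e / w * w)%R with e in HN' by (field; unfold w; lra).
  unfold Rdiv in Eb; unfold w in *; nra.
- assert (P2 : (0 < / 2 ^ N)%R) by (apply Rinv_0_lt_compat, pow_lt; lra).
  rewrite Rabs_right, pow_inv in HN' by (rewrite pow_inv; lra).
  apply Rmult_lt_compat_r with (r := w) in HN'; [|unfold w; lra].
  replace (e / w * w)%R with e in HN' by (field; unfold w; lra).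
  unfold Rdiv in Ed; unfold w in *; nra.
Qed.

(** Each entry is dodged by passing to an open half of the interval that misses it. This provides
    the translation that keeps poles off the boundary. *)
Lemma exists_avoiding (l : list R) (a b : R) : (a < b)%R ->
  exists x, (a < x < b)%R /\ ~ In x l.
Proof.
revert a b; induction l as [|y l IH]; intros a b Hab.
- exists ((a + b) / 2)%R; split; [lra|auto].
- destruct (Rle_dec y ((a + b) / 2)).
  + destruct (IH ((a + b) / 2)%R b) as [x [Hx Hi]]; [lra|].
    exists x; split; [lra|]; intros [E|E]; auto; lra.
  + destruct (IH a ((a + b) / 2)%R) as [x [Hx Hi]]; [lra|].
    exists x; split; [lra|]; intros [E|E]; auto; lra.
Qed.

(** Being a pole is not decidable, so filtering and removing duplicates rest on excluded middle. *)
Lemma list_comprehension {A : Type} (P : A -> Prop) (l : list A) :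
  exists l', NoDup l' /\ forall x, In x l' <-> In x l /\ P x.
Proof.
induction l as [|a l [l' [HN H]]].
- exists nil; split; [constructor|]; simpl; tauto.
- destruct (classic (P a /\ ~ In a l')) as [[Pa Na]|Hn].
  + exists (a :: l'); split; [now constructor|]; intros x; simpl; rewrite H.
    split; [intros [<-|[? ?]]; tauto|tauto].
  + exists l'; split; auto; intros x; simpl; rewrite H; split; [tauto|].
    intros [[<-|Hx] Px]; [|tauto].
    apply H; apply NNPP; tauto.
Qed.

(** * Integrals along the boundary of a parallelogram *)

Section Parallelogram.

Variables w1 w2 : C.

Definition pt (s t : R) : C := RtoC s * w1 + RtoC t * w2.

(** The contour integral of [g] along the boundary, counterclockwise in the coordinates (s, t); the
    factors [w1] and [w2] are the derivatives of [pt] along the sides. In the plane the orientation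
    is clockwise when the determinant of [w1] and [w2] is negative. *)
Definition bint (g : C -> C) (s0 s1 t0 t1 : R) : C :=
  w1 * CInt (fun s => g (pt s t0)) s0 s1 + w2 * CInt (fun t => g (pt s1 t)) t0 t1
  - w1 * CInt (fun s => g (pt s t1)) s0 s1 - w2 * CInt (fun t => g (pt s0 t)) t0 t1.

Definition bdry (s0 s1 t0 t1 s t : R) : Prop :=
  (s0 <= s <= s1)%R /\ (t0 <= t <= t1)%R /\ (s = s0 \/ s = s1 \/ t = t0 \/ t = t1).

Definition diff_bdry (g : C -> C) (s0 s1 t0 t1 : R) : Prop :=
  forall s t, bdry s0 s1 t0 t1 s t -> cdiff g (pt s t).

(** A Lipschitz constant of [pt] for the sum norm of the coordinates. Later denominators use
    [L + 1], which is positive at once. *)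
Let L : R := (Cmod w1 + Cmod w2)%R.

Lemma side_sum_ge_0 : (0 <= L)%R.
Proof. unfold L; pose proof (Cmod_ge_0 w1); pose proof (Cmod_ge_0 w2); lra. Qed.

Lemma pt_lip (s t s' t' : R) :
  (Cmod (pt s t - pt s' t') <= L * (Rabs (s - s') + Rabs (t - t')))%R.
Proof.
unfold pt.
replace (_ - _) with (RtoC (s - s') * w1 + RtoC (t - t') * w2)
  by (rewrite !RtoC_minus; ring).
eapply Rle_trans; [apply Cmod_triangle|]; rewrite !Cmod_mult, !Cmod_R; unfold L.
pose proof (Cmod_ge_0 w1); pose proof (Cmod_ge_0 w2).
pose proof (Rabs_pos (s - s')); pose proof (Rabs_pos (t - t')); nra.
Qed.

Lemma cdiff_cont_pt (g : C -> C) (s t : R) : cdiff g (pt s t) ->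
  forall e, (0 < e)%R -> exists d, (0 < d)%R /\ forall s' t',
    (Rabs (s' - s) + Rabs (t' - t) < d)%R -> (Cmod (g (pt s' t') - g (pt s t)) < e)%R.
Proof.
intros H e He; destruct (cdiff_cont _ _ H e He) as [d [Hd Hw]].
pose proof side_sum_ge_0 as PL.
exists (d / (L + 1))%R; split; [apply Rdiv_lt_0_compat; lra|].
intros s' t' Hx; apply Hw; eapply Rle_lt_trans; [apply pt_lip|].
set (x := (Rabs (s' - s) + Rabs (t' - t))%R) in *.
assert (0 <= x)%R by (unfold x; pose proof (Rabs_pos (s' - s)); pose proof (Rabs_pos (t' - t)); lra).
apply Rmult_lt_compat_r with (r := (L + 1)%R) in Hx; [|lra].
replace (d / (L + 1) * (L + 1))%R with d in Hx by (field; lra); nra.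
Qed.

Lemma ex_CInt_horizontal (g : C -> C) (a b t : R) : (a <= b)%R ->
  (forall s, (a <= s <= b)%R -> cdiff g (pt s t)) -> ex_CInt (fun s => g (pt s t)) a b.
Proof.
intros Hab H; apply ex_CInt_cont; auto; intros s Hs e He.
destruct (cdiff_cont_pt g s t (H s Hs) e He) as [d [Hd Hw]]; exists d; split; auto.
intros y Hy; apply Hw; rewrite Rminus_diag, Rabs_R0; lra.
Qed.

Lemma ex_CInt_slanted (g : C -> C) (a b s : R) : (a <= b)%R ->
  (forall t, (a <= t <= b)%R -> cdiff g (pt s t)) -> ex_CInt (fun t => g (pt s t)) a b.
Proof.
intros Hab H; apply ex_CInt_cont; auto; intros t Ht e He.
destruct (cdiff_cont_pt g s t (H t Ht) e He) as [d [Hd Hw]]; exists d; split; auto.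
intros y Hy; apply Hw; rewrite Rminus_diag, Rabs_R0; lra.
Qed.

Lemma diff_bdry_ex_CInt (g : C -> C) (s0 s1 t0 t1 : R) :
  (s0 <= s1)%R -> (t0 <= t1)%R -> diff_bdry g s0 s1 t0 t1 ->
  ex_CInt (fun s => g (pt s t0)) s0 s1 /\ ex_CInt (fun t => g (pt s1 t)) t0 t1 /\
  ex_CInt (fun s => g (pt s t1)) s0 s1 /\ ex_CInt (fun t => g (pt s0 t)) t0 t1.
Proof.
intros Hs Ht H; split; [|split; [|split]];
 [apply (ex_CInt_horizontal g s0 s1 t0)|apply (ex_CInt_slanted g t0 t1 s1)
 |apply (ex_CInt_horizontal g s0 s1 t1)|apply (ex_CInt_slanted g t0 t1 s0)];
 auto; intros; apply H; unfold bdry; repeat split; try lra; auto.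
Qed.

Lemma bint_plus (f g : C -> C) (s0 s1 t0 t1 : R) :
  (s0 <= s1)%R -> (t0 <= t1)%R -> diff_bdry f s0 s1 t0 t1 -> diff_bdry g s0 s1 t0 t1 ->
  bint (fun z => f z + g z) s0 s1 t0 t1 = bint f s0 s1 t0 t1 + bint g s0 s1 t0 t1.
Proof.
intros Hs Ht Hf Hg.
destruct (diff_bdry_ex_CInt f s0 s1 t0 t1) as (F1 & F2 & F3 & F4); auto.
destruct (diff_bdry_ex_CInt g s0 s1 t0 t1) as (G1 & G2 & G3 & G4); auto.
unfold bint; rewrite !CInt_plus; auto; ring.
Qed.

Lemma bint_scal (c : C) (f : C -> C) (s0 s1 t0 t1 : R) :
  (s0 <= s1)%R -> (t0 <= t1)%R -> diff_bdry f s0 s1 t0 t1 ->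
  bint (fun z => c * f z) s0 s1 t0 t1 = c * bint f s0 s1 t0 t1.
Proof.
intros Hs Ht Hf.
destruct (diff_bdry_ex_CInt f s0 s1 t0 t1) as (F1 & F2 & F3 & F4); auto.
unfold bint; rewrite !CInt_scal; auto; ring.
Qed.

Lemma bint_ext (f g : C -> C) (s0 s1 t0 t1 : R) :
  (s0 <= s1)%R -> (t0 <= t1)%R ->
  (forall s t, bdry s0 s1 t0 t1 s t -> f (pt s t) = g (pt s t)) ->
  bint f s0 s1 t0 t1 = bint g s0 s1 t0 t1.
Proof.
intros Hs Ht H; unfold bint.
rewrite (CInt_ext (fun s => f (pt s t0)) (fun s => g (pt s t0)) s0 s1),
  (CInt_ext (fun s => f (pt s t1)) (fun s => g (pt s t1)) s0 s1),
  (CInt_ext (fun t => f (pt s0 t)) (fun t => g (pt s0 t)) t0 t1),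
  (CInt_ext (fun t => f (pt s1 t)) (fun t => g (pt s1 t)) t0 t1); auto;
intros; apply H; unfold bdry; repeat split; try lra; auto.
Qed.

Lemma bint_split_s (f : C -> C) (s0 m s1 t0 t1 : R) :
  (s0 <= m <= s1)%R -> (t0 <= t1)%R ->
  diff_bdry f s0 m t0 t1 -> diff_bdry f m s1 t0 t1 ->
  bint f s0 s1 t0 t1 = bint f s0 m t0 t1 + bint f m s1 t0 t1.
Proof.
intros Hs Ht Hf Hg.
destruct (diff_bdry_ex_CInt f s0 m t0 t1) as (F1 & F2 & F3 & F4); auto; [lra|].
destruct (diff_bdry_ex_CInt f m s1 t0 t1) as (G1 & G2 & G3 & G4); auto; [lra|].
unfold bint.
rewrite (CInt_Chasles (fun s => f (pt s t0)) s0 m s1),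
  (CInt_Chasles (fun s => f (pt s t1)) s0 m s1); auto; ring.
Qed.

Lemma bint_split_t (f : C -> C) (s0 s1 t0 m t1 : R) :
  (s0 <= s1)%R -> (t0 <= m <= t1)%R ->
  diff_bdry f s0 s1 t0 m -> diff_bdry f s0 s1 m t1 ->
  bint f s0 s1 t0 t1 = bint f s0 s1 t0 m + bint f s0 s1 m t1.
Proof.
intros Hs Ht Hf Hg.
destruct (diff_bdry_ex_CInt f s0 s1 t0 m) as (F1 & F2 & F3 & F4); auto; [lra|].
destruct (diff_bdry_ex_CInt f s0 s1 m t1) as (G1 & G2 & G3 & G4); auto; [lra|].
unfold bint.
rewrite (CInt_Chasles (fun t => f (pt s0 t)) t0 m t1),
  (CInt_Chasles (fun t => f (pt s1 t)) t0 m t1); auto; ring.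
Qed.

(** Length times maximum, with the perimeter replaced by the larger [2 * L] times the half perimeter
    in coordinates, so that later estimates involve a single size. *)
Lemma bint_bound (f : C -> C) (s0 s1 t0 t1 M : R) :
  (s0 <= s1)%R -> (t0 <= t1)%R -> diff_bdry f s0 s1 t0 t1 ->
  (forall s t, bdry s0 s1 t0 t1 s t -> (Cmod (f (pt s t)) <= M)%R) ->
  (Cmod (bint f s0 s1 t0 t1) <= 2 * L * M * (s1 - s0 + (t1 - t0)))%R.
Proof.
intros Hs Ht Hf HM.
destruct (diff_bdry_ex_CInt f s0 s1 t0 t1) as (F1 & F2 & F3 & F4); auto.
apply CInt_bound with (M := M) in F1; auto;
  [|intros; apply HM; unfold bdry; repeat split; try lra; auto].
apply CInt_bound with (M := M) in F2; auto;
  [|intros; apply HM; unfold bdry; repeat split; try lra; auto].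
apply CInt_bound with (M := M) in F3; auto;
  [|intros; apply HM; unfold bdry; repeat split; try lra; auto].
apply CInt_bound with (M := M) in F4; auto;
  [|intros; apply HM; unfold bdry; repeat split; try lra; auto].
assert (0 <= M)%R.
{ eapply Rle_trans; [apply Cmod_ge_0|apply (HM s0 t0)]; unfold bdry; repeat split; try lra; auto. }
unfold bint.
set (I1 := CInt (fun s => f (pt s t0)) s0 s1) in *.
set (I2 := CInt (fun t => f (pt s1 t)) t0 t1) in *.
set (I3 := CInt (fun s => f (pt s t1)) s0 s1) in *.
set (I4 := CInt (fun t => f (pt s0 t)) t0 t1) in *.
assert (T : (Cmod (w1 * I1 + w2 * I2 - w1 * I3 - w2 * I4) <=
  Cmod w1 * Cmod I1 + Cmod w2 * Cmod I2 + Cmod w1 * Cmod I3 + Cmod w2 * Cmod I4)%R).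
{ rewrite <- !Cmod_mult.
  eapply Rle_trans; [apply Cmod_triangle|]; rewrite Cmod_opp; apply Rplus_le_compat_r.
  eapply Rle_trans; [apply Cmod_triangle|]; rewrite Cmod_opp; apply Rplus_le_compat_r.
  apply Cmod_triangle. }
eapply Rle_trans; [exact T|].
pose proof (Cmod_ge_0 w1) as P1; pose proof (Cmod_ge_0 w2) as P2.
assert (Q1 := Rmult_le_compat_l _ _ _ P1 F1); assert (Q2 := Rmult_le_compat_l _ _ _ P2 F2).
assert (Q3 := Rmult_le_compat_l _ _ _ P1 F3); assert (Q4 := Rmult_le_compat_l _ _ _ P2 F4).
assert (0 <= Cmod w2 * ((s1 - s0) * M))%R by (apply Rmult_le_pos; [lra|apply Rmult_le_pos; lra]).
assert (0 <= Cmod w1 * ((t1 - t0) * M))%R by (apply Rmult_le_pos; [lra|apply Rmult_le_pos; lra]).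
unfold L; lra.
Qed.

(** On opposite sides the integrand differs by a constant, and both differences contribute
    [A * w1 * w2] times the area in coordinates, with opposite signs. *)
Lemma bint_affine_eq_0 (A B : C) (s0 s1 t0 t1 : R) : (s0 <= s1)%R -> (t0 <= t1)%R ->
  bint (fun z => A * z + B) s0 s1 t0 t1 = 0.
Proof.
intros Hs Ht.
assert (Hd : diff_bdry (fun z => A * z + B) s0 s1 t0 t1).
{ intros s t _; apply cdiff_plus; [apply cdiff_scal, cdiff_id|apply cdiff_const]. }
destruct (diff_bdry_ex_CInt _ s0 s1 t0 t1 Hs Ht Hd) as (F1 & F2 & F3 & F4).
assert (ec : forall c a b, ex_CInt (fun _ => c) a b).
{ intros; apply (ex_RInt_const (V := C_R_NormedModule)). }
assert (E1 : CInt (fun s => A * pt s t1 + B) s0 s1 =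
  CInt (fun s => A * pt s t0 + B) s0 s1 + RtoC (s1 - s0) * (A * RtoC (t1 - t0) * w2)).
{ rewrite <- CInt_const, <- CInt_plus; auto; apply CInt_ext; auto; intros; unfold pt.
  rewrite RtoC_minus; ring. }
assert (E2 : CInt (fun t => A * pt s1 t + B) t0 t1 =
  CInt (fun t => A * pt s0 t + B) t0 t1 + RtoC (t1 - t0) * (A * RtoC (s1 - s0) * w1)).
{ rewrite <- CInt_const, <- CInt_plus; auto; apply CInt_ext; auto; intros; unfold pt.
  rewrite RtoC_minus; ring. }
unfold bint; rewrite E1, E2; ring.
Qed.

(* The square of the half perimeter in coordinates is preserved by cutting into
   four equal parts, so that a bound by a multiple of it can be proved locally. *)
Lemma goursat (g : C -> C) (s0 s1 t0 t1 : R) : (s0 <= s1)%R -> (t0 <= t1)%R ->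
  (forall s t, (s0 <= s <= s1)%R -> (t0 <= t <= t1)%R -> cdiff g (pt s t)) ->
  bint g s0 s1 t0 t1 = 0.
Proof.
intros Hs Ht Hg; apply Cmod_eq_0.
pose proof side_sum_ge_0 as PL.
assert (Hb : forall a b c d, (s0 <= a)%R -> (b <= s1)%R -> (t0 <= c)%R -> (d <= t1)%R ->
  diff_bdry g a b c d).
{ intros a b c d ? ? ? ? s t (? & ? & _); apply Hg; lra. }
set (W := (s1 - s0 + (t1 - t0))%R).
enough (H : forall e, (0 < e)%R -> (Cmod (bint g s0 s1 t0 t1) <= e * (W * W))%R).
{ apply Rle_antisym; [|apply Cmod_ge_0].
  apply le_epsilon; intros e He; rewrite Rplus_0_l.
  assert (0 <= W * W)%R by nra.
  eapply Rle_trans; [apply (H (e / (W * W + 1))%R); apply Rdiv_lt_0_compat; lra|].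
  apply Rmult_le_reg_r with (W * W + 1)%R; [lra|].
  replace (_ * _ * _)%R with (e * (W * W))%R by (field; lra); nra. }
intros e He.
apply (rectangle_bisection (fun a b c d => (Cmod (bint g a b c d) <=
  e * ((b - a + (d - c)) * (b - a + (d - c))))%R)); auto.
- intros a b c d m n Hab Hcd Ha Hb' Hc Hd P1 P2 P3 P4.
  assert (m = ((a + b) / 2)%R) by reflexivity.
  assert (n = ((c + d) / 2)%R) by reflexivity.
  clearbody m n.
  rewrite (bint_split_s g a m b c d) by (try lra; apply Hb; lra).
  rewrite (bint_split_t g a m c n d) by (try lra; apply Hb; lra).
  rewrite (bint_split_t g m b c n d) by (try lra; apply Hb; lra).
  eapply Rle_trans; [apply Cmod_triangle|].
  eapply Rle_trans; [apply Rplus_le_compat; apply Cmod_triangle|].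
  subst m n; lra.
- intros s t Hs' Ht'.
  destruct (Hg s t Hs' Ht') as [A HA].
  (* For a half perimeter [x], the remainder is at most [eta * L * x] on a contour of length at most
     [2 * L * x]; this [eta] brings the product below [e * x^2]. *)
  set (eta := (e / (2 * (L + 1) * (L + 1)))%R).
  assert (Peta : (0 < eta)%R) by (apply Rdiv_lt_0_compat; nra).
  destruct (HA eta Peta) as [d [Hd H]].
  exists (d / (2 * (L + 1)))%R; split; [apply Rdiv_lt_0_compat; lra|].
  intros a b c k Ha Has Hb' Hc Hct Hk Hba Hkc.
  set (x := (b - a + (k - c))%R).
  assert (Hx : ((L + 1) * x < d)%R).
  { unfold x; assert (Hl : (0 < 2 * (L + 1))%R) by lra.
    assert (Q1 := Rmult_lt_compat_r _ _ _ Hl Hba); assert (Q2 := Rmult_lt_compat_r _ _ _ Hl Hkc).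
    replace (d / (2 * (L + 1)) * (2 * (L + 1)))%R with d in * by (field; lra); lra. }
  assert (Px : (0 <= x)%R) by (unfold x; lra).
  (* The tangent map of [g] at [pt s t] is subtracted; its boundary integral is zero, so only the
     remainder counts. *)
  set (r := fun z => g z + ((- A) * z + (A * pt s t - g (pt s t)))).
  assert (Hr : diff_bdry (fun z => (- A) * z + (A * pt s t - g (pt s t))) a b c k).
  { intros ? ? _; apply cdiff_plus; [apply cdiff_scal, cdiff_id|apply cdiff_const]. }
  assert (E : bint g a b c k = bint r a b c k).
  { unfold r; rewrite (bint_plus g _ a b c k ltac:(lra) ltac:(lra) (Hb a b c k Ha Hb' Hc Hk) Hr).
    rewrite bint_affine_eq_0 by lra; ring. }
  rewrite E.
  eapply Rle_trans; [apply (bint_bound r a b c k (eta * (L * x))%R); try lra|].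
  + intros s' t' Hst; apply cdiff_plus; [apply (Hb a b c k); auto; lra|apply Hr, Hst].
  + intros s' t' (Q1 & Q2 & _).
    assert (Hp : (Cmod (pt s' t' - pt s t) <= L * x)%R).
    { eapply Rle_trans; [apply pt_lip|]; apply Rmult_le_compat_l; auto.
      unfold x; assert (Rabs (s' - s) <= b - a)%R by (apply Rabs_le; lra).
      assert (Rabs (t' - t) <= k - c)%R by (apply Rabs_le; lra); lra. }
    replace (r (pt s' t')) with (g (pt s' t') - g (pt s t) - A * (pt s' t' - pt s t))
      by (unfold r; ring).
    eapply Rle_trans; [apply H; nra|]; apply Rmult_le_compat_l; lra.
  + fold x; replace (2 * L * (eta * (L * x)) * x)%R with (eta * (2 * L * L) * (x * x))%R by ring.
    apply Rmult_le_compat_r; [nra|].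
    apply Rmult_le_reg_r with ((L + 1) * (L + 1))%R; [nra|].
    unfold eta; replace (_ * _ * _)%R with (e * (L * L))%R by (field; lra); nra.
Qed.

(** The left, right, lower and upper strips around the small square avoid the exceptional point, so
    Goursat's lemma removes them one after another. *)
Lemma bint_shrink (g : C -> C) (s0 s1 t0 t1 s t r : R) : (0 < r)%R ->
  (s0 <= s - r)%R -> (s + r <= s1)%R -> (t0 <= t - r)%R -> (t + r <= t1)%R ->
  (forall s' t', (s0 <= s' <= s1)%R -> (t0 <= t' <= t1)%R -> (s', t') <> (s, t) ->
     cdiff g (pt s' t')) ->
  bint g s0 s1 t0 t1 = bint g (s - r) (s + r) (t - r) (t + r).
Proof.
intros Hr ? ? ? ? Hg.
assert (ne : forall s' t', s' <> s \/ t' <> t -> (s', t') <> (s, t)).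
{ intros s' t' H' E; injection E; intros; tauto. }
rewrite (bint_split_s g s0 (s - r) s1); try lra.
2,3: intros s' t' (? & ? & ?); apply Hg; try lra; apply ne; lra.
rewrite (goursat g s0 (s - r)); try lra.
2: intros; apply Hg; try lra; apply ne; lra.
rewrite (bint_split_s g (s - r) (s + r) s1); try lra.
2,3: intros s' t' (? & ? & ?); apply Hg; try lra; apply ne; lra.
rewrite (goursat g (s + r) s1); try lra.
2: intros; apply Hg; try lra; apply ne; lra.
rewrite (bint_split_t g (s - r) (s + r) t0 (t - r) t1); try lra.
2,3: intros s' t' (? & ? & ?); apply Hg; try lra; apply ne; lra.
rewrite (goursat g (s - r) (s + r) t0); try lra.
2: intros; apply Hg; try lra; apply ne; lra.
rewrite (bint_split_t g (s - r) (s + r) (t - r) (t + r) t1); try lra.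
2,3: intros s' t' (? & ? & ?); apply Hg; try lra; apply ne; lra.
rewrite (goursat g (s - r) (s + r) (t + r)); try lra.
2: intros; apply Hg; try lra; apply ne; lra.
ring.
Qed.

(** * Coordinates in the plane and bounded singularities *)

Let D : R := (Re w1 * Im w2 - Im w1 * Re w2)%R.
Hypothesis HD : D <> 0%R.

(** Cramer's rule for the inverse of [pt]. *)
Definition coord1 (z : C) : R := ((Re z * Im w2 - Im z * Re w2) / D)%R.
Definition coord2 (z : C) : R := ((Re w1 * Im z - Im w1 * Re z) / D)%R.

Lemma pt_coord (z : C) : pt (coord1 z) (coord2 z) = z.
Proof.
unfold pt, coord1, coord2, D in *; destruct z, w1, w2.
unfold Re, Im in *; simpl in *; unfold Cplus, Cmult; simpl; f_equal; field; auto.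
Qed.

Lemma coord1_pt (s t : R) : coord1 (pt s t) = s.
Proof.
unfold pt, coord1, D in *; destruct w1, w2; unfold Re, Im in *; simpl in *; field; auto.
Qed.

Lemma coord2_pt (s t : R) : coord2 (pt s t) = t.
Proof.
unfold pt, coord2, D in *; destruct w1, w2; unfold Re, Im in *; simpl in *; field; auto.
Qed.

Lemma pt_inj (s t s' t' : R) : pt s t = pt s' t' -> (s, t) = (s', t').
Proof.
intros E; assert (E1 := f_equal coord1 E); assert (E2 := f_equal coord2 E).
rewrite !coord1_pt in E1; rewrite !coord2_pt in E2; congruence.
Qed.

(** The numerators in Cramer's rule are bounded by [2 * L * Cmod z]. The constant turns distances in
    the plane into distances in coordinates, so that a small disc fits inside a parallelogram. *)
Lemma coord_lip : exists k : R, (0 < k)%R /\ forall s t s' t',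
  (Rabs (s - s') <= k * Cmod (pt s t - pt s' t'))%R /\
  (Rabs (t - t') <= k * Cmod (pt s t - pt s' t'))%R.
Proof.
assert (PD := Rabs_pos_lt D HD).
pose proof (Cmod_ge_0 w1) as P1; pose proof (Cmod_ge_0 w2) as P2.
assert (H2 : forall x y u v m n : R, (Rabs x <= m -> Rabs u <= m -> Rabs y <= n -> Rabs v <= n ->
  Rabs (x * y - u * v) <= 2 * n * m)%R).
{ intros x y u v m n Hx Hu Hy Hv.
  assert (Q1 := Rabs_pos x); assert (Q2 := Rabs_pos y).
  assert (Q3 := Rabs_pos u); assert (Q4 := Rabs_pos v).
  unfold Rminus; eapply Rle_trans; [apply Rabs_triang|].
  rewrite Rabs_Ropp, !Rabs_mult; nra. }
exists ((2 * L + 1) / Rabs D)%R; split; [unfold L; apply Rdiv_lt_0_compat; lra|].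
intros s t s' t'; set (z := pt s t - pt s' t').
pose proof (Cmod_ge_0 z) as Pz.
assert (Ez : z = pt (s - s') (t - t')).
{ unfold z, pt; rewrite !RtoC_minus; ring. }
assert (E1 := coord1_pt (s - s') (t - t')); assert (E2 := coord2_pt (s - s') (t - t')).
rewrite <- Ez in E1, E2; rewrite <- E1, <- E2.
unfold coord1, coord2; rewrite !Rabs_div by auto.
replace ((2 * L + 1) / Rabs D * Cmod z)%R with ((2 * L + 1) * Cmod z / Rabs D)%R by (field; lra).
split; apply Rmult_le_compat_r; try (left; now apply Rinv_0_lt_compat).
- eapply Rle_trans; [apply H2 with (m := Cmod z) (n := Cmod w2); auto using re_le_Cmod, im_le_Cmod|].
  unfold L; nra.
- eapply Rle_trans; [apply H2 with (m := Cmod w1) (n := Cmod z); auto using re_le_Cmod, im_le_Cmod|].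
  unfold L; nra.
Qed.

Definition inner (s0 s1 t0 t1 : R) (s t : R) : Prop := (s0 < s < s1)%R /\ (t0 < t < t1)%R.

Lemma inner_dist_bdry (s0 s1 t0 t1 s t : R) : inner s0 s1 t0 t1 s t ->
  exists r : R, (0 < r)%R /\ forall s' t', bdry s0 s1 t0 t1 s' t' ->
    (r <= Cmod (pt s' t' - pt s t))%R.
Proof.
intros [Hs Ht]; destruct coord_lip as [k [Hk H]].
set (m := Rmin (Rmin (s - s0) (s1 - s)) (Rmin (t - t0) (t1 - t))).
assert (Hm : (0 < m)%R) by (unfold m; repeat apply Rmin_pos; lra).
assert (M1 : (m <= s - s0)%R) by (unfold m; eapply Rle_trans; [apply Rmin_l|apply Rmin_l]).
assert (M2 : (m <= s1 - s)%R) by (unfold m; eapply Rle_trans; [apply Rmin_l|apply Rmin_r]).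
assert (M3 : (m <= t - t0)%R) by (unfold m; eapply Rle_trans; [apply Rmin_r|apply Rmin_l]).
assert (M4 : (m <= t1 - t)%R) by (unfold m; eapply Rle_trans; [apply Rmin_r|apply Rmin_r]).
exists (m / k)%R; split; [now apply Rdiv_lt_0_compat|].
intros s' t' (_ & _ & Hb); destruct (H s' t' s t) as [H1 H2].
apply Rmult_le_reg_l with k; auto.
replace (k * (m / k))%R with m by (field; lra).
destruct Hb as [-> | [-> | [-> | ->]]];
[eapply Rle_trans; [|exact H1]|eapply Rle_trans; [|exact H1]
|eapply Rle_trans; [|exact H2]|eapply Rle_trans; [|exact H2]];
unfold Rabs; destruct Rcase_abs; lra.
Qed.

Lemma inner_neq_bdry (s0 s1 t0 t1 s t s' t' : R) : inner s0 s1 t0 t1 s t ->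
  bdry s0 s1 t0 t1 s' t' -> pt s' t' <> pt s t.
Proof.
intros [? ?] (_ & _ & ?) E; apply pt_inj in E; injection E; intros; lra.
Qed.

Lemma inner_small_square (s0 s1 t0 t1 s t : R) : inner s0 s1 t0 t1 s t ->
  exists r0 : R, (0 < r0)%R /\ forall r, (0 < r <= r0)%R ->
    (s0 <= s - r)%R /\ (s + r <= s1)%R /\ (t0 <= t - r)%R /\ (t + r <= t1)%R.
Proof.
intros [Hs Ht].
exists (Rmin (Rmin (s - s0) (s1 - s)) (Rmin (t - t0) (t1 - t))).
split; [repeat apply Rmin_pos; lra|]; intros r [_ Hr].
pose proof (Rmin_l (s - s0) (s1 - s)); pose proof (Rmin_r (s - s0) (s1 - s)).
pose proof (Rmin_l (t - t0) (t1 - t)); pose proof (Rmin_r (t - t0) (t1 - t)).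
pose proof (Rle_trans _ _ _ Hr (Rmin_l _ _)); pose proof (Rle_trans _ _ _ Hr (Rmin_r _ _)).
lra.
Qed.

(** The contour shrinks to squares about the point, where the integrand stays bounded while the
    perimeter tends to 0. *)
Lemma goursat_removable (g : C -> C) (s0 s1 t0 t1 s t M d : R) :
  inner s0 s1 t0 t1 s t ->
  (forall s' t', (s0 <= s' <= s1)%R -> (t0 <= t' <= t1)%R -> (s', t') <> (s, t) ->
     cdiff g (pt s' t')) ->
  (0 < d)%R ->
  (forall z, z <> pt s t -> (Cmod (z - pt s t) < d)%R -> (Cmod (g z) <= M)%R) ->
  bint g s0 s1 t0 t1 = 0.
Proof.
intros Hin Hg Hd HM; apply Cmod_eq_0.
destruct (inner_small_square _ _ _ _ _ _ Hin) as [r0 [Hr0 Hsq]].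
assert (PL : (0 <= L)%R) by apply side_sum_ge_0.
apply Rle_antisym; [|apply Cmod_ge_0]; apply le_epsilon; intros e He; rewrite Rplus_0_l.
set (M' := (Rabs M + 1)%R).
assert (PM : (0 < M')%R) by (unfold M'; pose proof (Rabs_pos M); lra).
(* The three bounds make the square fit in the parallelogram, lie in the disc of radius [d], and
   satisfy [8 * L * M' * r <= e], the left side being the length bound times [M']. *)
set (r := Rmin r0 (Rmin (d / (4 * (L + 1))) (e / (8 * (L + 1) * M')))).
assert (Hr : (0 < r)%R).
{ unfold r; repeat apply Rmin_pos; auto; apply Rdiv_lt_0_compat; auto; [lra|].
  apply Rmult_lt_0_compat; lra. }
assert (R1 : (r <= r0)%R) by apply Rmin_l.
assert (R2 : (r * (4 * (L + 1)) <= d)%R).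
{ apply Rle_trans with (d / (4 * (L + 1)) * (4 * (L + 1)))%R; [|right; field; lra].
  apply Rmult_le_compat_r; [lra|]; eapply Rle_trans; [apply Rmin_r|apply Rmin_l]. }
assert (R3 : (r * (8 * (L + 1) * M') <= e)%R).
{ apply Rle_trans with (e / (8 * (L + 1) * M') * (8 * (L + 1) * M'))%R; [|right; field; lra].
  apply Rmult_le_compat_r; [apply Rmult_le_pos; lra|].
  eapply Rle_trans; [apply Rmin_r|apply Rmin_r]. }
destruct (Hsq r) as (S1 & S2 & S3 & S4); [lra|].
rewrite (bint_shrink g s0 s1 t0 t1 s t r); auto.
assert (Hin' : inner (s - r) (s + r) (t - r) (t + r) s t) by (split; lra).
eapply Rle_trans; [apply (bint_bound g _ _ _ _ M')|]; try lra.
- intros s' t' Hb; apply Hg; try (destruct Hb as (? & ? & _); lra).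
  intros E; apply (inner_neq_bdry _ _ _ _ _ _ _ _ Hin' Hb); injection E; intros; subst; auto.
- intros s' t' Hb; eapply Rle_trans; [apply HM|].
  + apply (inner_neq_bdry _ _ _ _ _ _ _ _ Hin' Hb).
  + eapply Rle_lt_trans; [apply pt_lip|]; fold L; destruct Hb as (? & ? & _).
    assert (Rabs (s' - s) <= r)%R by (apply Rabs_le; lra).
    assert (Rabs (t' - t) <= r)%R by (apply Rabs_le; lra).
    apply Rle_lt_trans with (L * (2 * r))%R; [apply Rmult_le_compat_l; lra|nra].
  + unfold M'; pose proof (Rle_abs M); lra.
- fold L; nra.
Qed.

(** * Integrals of negative powers *)

Lemma bint_rescale (g : C -> C) (s t r : R) : (0 < r)%R ->
  diff_bdry g (s - r) (s + r) (t - r) (t + r) ->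
  bint g (s - r) (s + r) (t - r) (t + r) =
  RtoC r * bint (fun z => g (pt s t + RtoC r * z)) (-1) 1 (-1) 1.
Proof.
intros Hr Hg.
destruct (diff_bdry_ex_CInt g (s - r) (s + r) (t - r) (t + r)) as (F1 & F2 & F3 & F4);
  auto; try lra.
assert (Hg' : diff_bdry (fun z => g (pt s t + RtoC r * z)) (-1) 1 (-1) 1).
{ intros x y (Hx & Hy & Hb); apply (cdiff_comp g).
  - apply cdiff_plus; [apply cdiff_const|apply cdiff_scal, cdiff_id].
  - replace (pt s t + RtoC r * pt x y) with (pt (r * x + s) (r * y + t))
      by (unfold pt; rewrite !RtoC_plus, !RtoC_mult; ring).
    apply Hg; repeat split; nra. }
destruct (diff_bdry_ex_CInt (fun z => g (pt s t + RtoC r * z)) (-1) 1 (-1) 1)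
  as (G1 & G2 & G3 & G4); auto; try lra.
assert (A : forall f : R -> C, forall x, ex_CInt f (x - r) (x + r) ->
  CInt f (x - r) (x + r) = CInt (fun y => RtoC r * f (r * y + x)%R) (-1) 1).
{ intros f x; replace (x - r)%R with (r * (-1) + x)%R by ring.
  replace (x + r)%R with (r * 1 + x)%R by ring; apply CInt_affine. }
unfold bint; rewrite !A; auto.
assert (E : forall x y, pt (r * x + s) (r * y + t) = pt s t + RtoC r * pt x y).
{ intros; unfold pt; rewrite !RtoC_plus, !RtoC_mult; ring. }
rewrite (CInt_ext (fun y => RtoC r * g (pt (r * y + s) (t - r)))
  (fun x => RtoC r * g (pt s t + RtoC r * pt x (-1))) (-1) 1);
  [|lra|intros; rewrite <- E; replace (r * (-1) + t)%R with (t - r)%R by ring; reflexivity].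
rewrite (CInt_ext (fun y => RtoC r * g (pt (r * y + s) (t + r)))
  (fun x => RtoC r * g (pt s t + RtoC r * pt x 1)) (-1) 1);
  [|lra|intros; rewrite <- E; replace (r * 1 + t)%R with (t + r)%R by ring; reflexivity].
rewrite (CInt_ext (fun y => RtoC r * g (pt (s - r) (r * y + t)))
  (fun x => RtoC r * g (pt s t + RtoC r * pt (-1) x)) (-1) 1);
  [|lra|intros; rewrite <- E; replace (r * (-1) + s)%R with (s - r)%R by ring; reflexivity].
rewrite (CInt_ext (fun y => RtoC r * g (pt (s + r) (r * y + t)))
  (fun x => RtoC r * g (pt s t + RtoC r * pt 1 x)) (-1) 1);
  [|lra|intros; rewrite <- E; replace (r * 1 + s)%R with (s + r)%R by ring; reflexivity].
rewrite !CInt_scal; auto; ring.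
Qed.

(* This is [2 i pi] up to orientation, but only its being nonzero matters. *)
Definition wind : C := bint (fun z => / z) (-1) 1 (-1) 1.

Lemma pt_neq (s t s' t' : R) : (s', t') <> (s, t) -> pt s' t' <> pt s t.
Proof. intros H E; apply H, (pt_inj), E. Qed.

(** When [p] runs along a side with velocity [w], the imaginary part of [w / p] is the angular speed
    seen from 0, here [D / Cmod (p x) ^ 2]. Multiplying by [D] makes the sign independent of the
    orientation, and the bound on [p] keeps the integrand above a positive constant. *)
Lemma Im_CInt_pos (w : C) (p : R -> C) : ex_CInt (fun x => / p x) (-1) 1 ->
  (forall x, (-1 <= x <= 1)%R -> p x <> 0 /\ (Cmod (p x) <= 2 * L)%R /\
     (Im w * Re (p x) - Re w * Im (p x))%R = D) ->
  (0 < D * Im (w * CInt (fun x => / p x) (-1) 1)%C)%R.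
Proof.
intros Hex Hp.
assert (PL : (0 < L)%R).
{ destruct (Hp 0%R) as (H0 & H1 & _); [lra|]; apply Cmod_gt_0 in H0; lra. }
assert (HI := is_CInt_scal w _ _ _ _ (CInt_correct _ _ _ Hex)).
apply CInt_unique in HI as HE; rewrite <- HE.
assert (HIm := Im_CInt _ _ _ (ex_intro _ _ HI)).
apply (is_RInt_scal (V := R_NormedModule) _ _ _ D) in HIm.
assert (PD : (0 < D * D)%R) by nra.
set (m := (D * D / (2 * L) ^ 2)%R).
assert (Pm : (0 < m)%R) by (apply Rdiv_lt_0_compat; [auto|apply pow_lt; lra]).
assert (Hc := is_RInt_const (V := R_NormedModule) (-1) 1 m).
assert (Hle := is_RInt_le _ _ (-1) 1 _ _ ltac:(lra) Hc HIm).
unfold scal in Hle; simpl in Hle; unfold mult in Hle; simpl in Hle.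
apply Rlt_le_trans with ((1 - -1) * m)%R; [lra|apply Hle].
intros x Hx; destruct (Hp x) as (H0 & H1 & H2); [lra|].
change (m <= D * Im (w * / p x)%C)%R.
rewrite Im_mult_inv, H2, <- Cmod2_alt by auto.
apply Cmod_gt_0 in H0; unfold m.
replace (D * (D / Cmod (p x) ^ 2))%R with (D * D / Cmod (p x) ^ 2)%R by (field; lra).
apply Rmult_le_compat_l; [lra|]; apply Rinv_le_contravar; [apply pow_lt; lra|].
apply pow_incr; lra.
Qed.

(* On each of the four sides the imaginary part of the integrand has the sign of [D]. *)
Lemma wind_neq_0 : wind <> 0.
Proof.
intros E.
assert (Hn : forall s t, (s <> 0 \/ t <> 0)%R -> pt s t <> 0).
{ intros s t H; replace (RtoC 0) with (pt 0 0) by (unfold pt; ring).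
  apply pt_neq; intros E'; injection E'; intros; lra. }
assert (Hl : forall s t, (-1 <= s <= 1)%R -> (-1 <= t <= 1)%R -> (Cmod (pt s t) <= 2 * L)%R).
{ intros s t Hs Ht; replace (pt s t) with (pt s t - pt 0 0) by (unfold pt; ring).
  eapply Rle_trans; [apply pt_lip|]; fold L.
  assert (0 <= L)%R by apply side_sum_ge_0.
  rewrite !Rminus_0_r.
  assert (Rabs s <= 1)%R by (apply Rabs_le; lra).
  assert (Rabs t <= 1)%R by (apply Rabs_le; lra); nra. }
assert (Hd : diff_bdry (fun z => / z) (-1) 1 (-1) 1).
{ intros s t (_ & _ & Hb); apply cdiff_inv, Hn; destruct Hb as [-> | [-> | [-> | ->]]]; lra. }
destruct (diff_bdry_ex_CInt (fun z => / z) (-1) 1 (-1) 1) as (F1 & F2 & F3 & F4);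
  auto; try lra.
assert (Hre : forall s t, Re (pt s t) = (s * Re w1 + t * Re w2)%R).
{ intros; unfold pt; destruct w1, w2; unfold Re; simpl; ring. }
assert (Him : forall s t, Im (pt s t) = (s * Im w1 + t * Im w2)%R).
{ intros; unfold pt; destruct w1, w2; unfold Im; simpl; ring. }
assert (Hro : forall z, Re (- z) = (- Re z)%R) by (intros []; reflexivity).
assert (Hio : forall z, Im (- z) = (- Im z)%R) by (intros []; reflexivity).
assert (P1 : (0 < D * Im (w1 * CInt (fun s => / pt s (-1)) (-1) 1)%C)%R).
{ apply Im_CInt_pos; auto; intros x Hx; repeat split; [apply Hn; lra|apply Hl; lra|].
  rewrite Hre, Him; unfold D; ring. }
assert (P2 : (0 < D * Im (w2 * CInt (fun t => / pt 1 t) (-1) 1)%C)%R).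
{ apply Im_CInt_pos; auto; intros x Hx; repeat split; [apply Hn; lra|apply Hl; lra|].
  rewrite Hre, Him; unfold D; ring. }
(* The two sides run backwards enter with velocities [- w1] and [- w2] but unchanged
   parametrisation, so the angular numerator is again [D]. *)
assert (P3 : (0 < D * Im (- w1 * CInt (fun s => / pt s 1) (-1) 1)%C)%R).
{ apply Im_CInt_pos; auto; intros x Hx; repeat split; [apply Hn; lra|apply Hl; lra|].
  rewrite Hre, Him, Hro, Hio; unfold D; ring. }
assert (P4 : (0 < D * Im (- w2 * CInt (fun t => / pt (-1) t) (-1) 1)%C)%R).
{ apply Im_CInt_pos; auto; intros x Hx; repeat split; [apply Hn; lra|apply Hl; lra|].
  rewrite Hre, Him, Hro, Hio; unfold D; ring. }
assert (E' : Im wind = 0%R) by (rewrite E; reflexivity).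
assert (E2 : wind = w1 * CInt (fun s => / pt s (-1)) (-1) 1 +
  (w2 * CInt (fun t => / pt 1 t) (-1) 1 + (- w1 * CInt (fun s => / pt s 1) (-1) 1 +
   - w2 * CInt (fun t => / pt (-1) t) (-1) 1))) by (unfold wind, bint; ring).
rewrite E2 in E'.
assert (Hip : forall x y, Im (x + y) = (Im x + Im y)%R) by reflexivity.
rewrite !Hip in E'.
apply (f_equal (Rmult D)) in E'; lra.
Qed.

(** After shrinking to a square centred at the pole, the factor [r0] from the change of variable
    cancels the one in the denominator; hence one constant serves all poles and all
    parallelograms. *)
Lemma bint_inv (s0 s1 t0 t1 s t : R) : inner s0 s1 t0 t1 s t ->
  bint (fun z => / (z - pt s t)) s0 s1 t0 t1 = wind.
Proof.
intros Hin.
destruct (inner_small_square _ _ _ _ _ _ Hin) as [r0 [Hr0 Hsq]].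
destruct (Hsq r0) as (S1 & S2 & S3 & S4); [lra|].
assert (Hc : forall a z, z <> a -> cdiff (fun x => / (x - a)) z).
{ intros a z Hz; apply (cdiff_comp (fun x => / x)); [apply cdiff_sub_const|].
  apply cdiff_inv, Csub_neq_0, Hz. }
rewrite (bint_shrink _ s0 s1 t0 t1 s t r0); auto; try lra.
2: intros; apply Hc, pt_neq; auto.
assert (Hin' : inner (s - r0) (s + r0) (t - r0) (t + r0) s t) by (split; lra).
rewrite bint_rescale; auto.
2:{ intros s' t' Hb; apply Hc; apply (inner_neq_bdry _ _ _ _ _ _ _ _ Hin' Hb). }
assert (Hin1 : inner (-1) 1 (-1) 1 0 0) by (split; lra).
assert (Hn : forall s' t', bdry (-1) 1 (-1) 1 s' t' -> pt s' t' <> 0).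
{ intros s' t' Hb; replace (RtoC 0) with (pt 0 0) by (unfold pt; ring).
  apply (inner_neq_bdry _ _ _ _ _ _ _ _ Hin1 Hb). }
assert (Hr : RtoC r0 <> 0) by (intros E; apply RtoC_inj in E; lra).
rewrite (bint_ext _ (fun z => / RtoC r0 * / z)) by
 (try lra; intros s' t' Hb; field; repeat split; auto;
  replace (_ - _) with (RtoC r0 * pt s' t') by ring; apply Cmult_neq_0; auto).
rewrite (bint_scal (/ RtoC r0) (fun z => / z)); try lra; [fold wind; field; auto|].
intros s' t' Hb; apply cdiff_inv; auto.
Qed.

(* Shrinking the parallelogram leaves the integral unchanged, while rescaling
   multiplies it by a nonzero power of the size: hence it vanishes. *)
Lemma bint_inv_pow (k : nat) (s0 s1 t0 t1 s t : R) : inner s0 s1 t0 t1 s t ->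
  bint (fun z => / (z - pt s t) ^ S (S k)) s0 s1 t0 t1 = 0.
Proof.
intros Hin.
destruct (inner_small_square _ _ _ _ _ _ Hin) as [r0 [Hr0 Hsq]].
set (I := bint (fun z => / z ^ S (S k)) (-1) 1 (-1) 1).
assert (Hin1 : inner (-1) 1 (-1) 1 0 0) by (split; lra).
assert (Hn : forall s' t', bdry (-1) 1 (-1) 1 s' t' -> pt s' t' <> 0).
{ intros s' t' Hb; replace (RtoC 0) with (pt 0 0) by (unfold pt; ring).
  apply (inner_neq_bdry _ _ _ _ _ _ _ _ Hin1 Hb). }
(* Rescaling contributes [r] from the change of variable and [r] to the power [- (k + 2)] from the
   integrand, hence the exponent [S k], which is positive. *)
assert (H : forall r, (0 < r <= r0)%R ->
  bint (fun z => / (z - pt s t) ^ S (S k)) s0 s1 t0 t1 * RtoC r ^ S k = I).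
{ intros r Hr; destruct (Hsq r) as (S1 & S2 & S3 & S4); [lra|].
  rewrite (bint_shrink _ s0 s1 t0 t1 s t r); auto; try lra.
  2: intros; apply cdiff_inv_pow, pt_neq; auto.
  assert (Hin' : inner (s - r) (s + r) (t - r) (t + r) s t) by (split; lra).
  rewrite bint_rescale; try lra.
  2:{ intros s' t' Hb; apply cdiff_inv_pow; apply (inner_neq_bdry _ _ _ _ _ _ _ _ Hin' Hb). }
  assert (Hr' : RtoC r <> 0) by (intros E; apply RtoC_inj in E; lra).
  rewrite (bint_ext _ (fun z => / RtoC r ^ S (S k) * / z ^ S (S k))); try lra.
  - rewrite bint_scal; try lra.
    + fold I; rewrite (Cpow_S _ (S k)); field; split; auto; now apply Cpow_nz.
    + intros s' t' Hb; apply (cdiff_comp (fun x => / x) (fun x => x ^ S (S k))).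
      * apply cdiff_pow, cdiff_id.
      * apply cdiff_inv, Cpow_nz; auto.
  - intros s' t' Hb.
    replace (pt s t + RtoC r * pt s' t' - pt s t) with (RtoC r * pt s' t') by ring.
    rewrite Cpow_mult_l; field; split; apply Cpow_nz; auto. }
(* Two radii with different powers suffice: the same [I] is the product of the integral with
   both. *)
assert (H1 := H r0 ltac:(lra)); assert (H2 := H (r0 / 2)%R ltac:(lra)).
set (J := bint (fun z => / (z - pt s t) ^ S (S k)) s0 s1 t0 t1) in *.
rewrite <- H2 in H1.
rewrite <- !RtoC_pow in H1.
assert (Q : (0 < r0 ^ S k - (r0 / 2) ^ S k)%R).
{ apply Rlt_0_minus; simpl.
  assert ((r0 / 2) ^ k <= r0 ^ k)%R by (apply pow_incr; lra).
  assert (0 < (r0 / 2) ^ k)%R by (apply pow_lt; lra); nra. }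
assert (E : J * RtoC (r0 ^ S k - (r0 / 2) ^ S k) = 0) by (rewrite RtoC_minus;
  replace (J * _) with (J * RtoC (r0 ^ S k) - J * RtoC ((r0 / 2) ^ S k)) by ring; rewrite H1; ring).
destruct (Ceq_dec J 0) as [HJ|HJ]; auto; exfalso.
apply (Cmult_neq_0 _ _ HJ) in E; auto; intros E'; apply RtoC_inj in E'; lra.
Qed.

(** * Cauchy's formula and principal parts *)

Lemma bounded_bdry (f : C -> C) (s0 s1 t0 t1 : R) : diff_bdry f s0 s1 t0 t1 ->
  exists M : R, (0 <= M)%R /\
    forall s t, bdry s0 s1 t0 t1 s t -> (Cmod (f (pt s t)) <= M)%R.
Proof.
intros H.
assert (Hs : forall t, (forall s, (s0 <= s <= s1)%R -> bdry s0 s1 t0 t1 s t) ->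
  exists M, forall s, (s0 <= s <= s1)%R -> (Cmod (f (pt s t)) <= M)%R).
{ intros t Hb; apply (bounded_segment (fun s => f (pt s t))); intros s Hs e He.
  destruct (cdiff_cont_pt f s t (H _ _ (Hb s Hs)) e He) as [d [Hd Hw]].
  exists d; split; auto; intros y Hy; apply Hw; rewrite Rminus_diag, Rabs_R0; lra. }
assert (Ht : forall s, (forall t, (t0 <= t <= t1)%R -> bdry s0 s1 t0 t1 s t) ->
  exists M, forall t, (t0 <= t <= t1)%R -> (Cmod (f (pt s t)) <= M)%R).
{ intros s Hb; apply (bounded_segment (fun t => f (pt s t))); intros t Ht e He.
  destruct (cdiff_cont_pt f s t (H _ _ (Hb t Ht)) e He) as [d [Hd Hw]].
  exists d; split; auto; intros y Hy; apply Hw; rewrite Rminus_diag, Rabs_R0; lra. }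
destruct (classic (s0 <= s1 /\ t0 <= t1)%R) as [[Hs' Ht']|Hn].
2:{ exists 0%R; split; [lra|]; intros s t (Q1 & Q2 & _); exfalso; apply Hn; lra. }
destruct (Hs t0) as [M1 H1]; [unfold bdry; intros; lra|].
destruct (Hs t1) as [M2 H2]; [unfold bdry; intros; lra|].
destruct (Ht s0) as [M3 H3]; [unfold bdry; intros; lra|].
destruct (Ht s1) as [M4 H4]; [unfold bdry; intros; lra|].
exists (Rabs M1 + Rabs M2 + Rabs M3 + Rabs M4)%R.
pose proof (Rabs_pos M1); pose proof (Rabs_pos M2); pose proof (Rabs_pos M3); pose proof (Rabs_pos M4).
pose proof (Rle_abs M1); pose proof (Rle_abs M2); pose proof (Rle_abs M3); pose proof (Rle_abs M4).
split; [lra|]; intros s t (Q1 & Q2 & Hb).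
destruct Hb as [-> | [-> | [-> | ->]]];
[specialize (H3 t Q2)|specialize (H4 t Q2)|specialize (H1 s Q1)|specialize (H2 s Q1)]; lra.
Qed.

(** Differentiation under the integral comes from the exact identity 1/(x-z) = 1/(x-a) +
    (z-a)/(x-a)^2 + (z-a)^2/((x-z)(x-a)^2), whose last term has a boundary integral bounded
    uniformly for [z] near [a]. *)
Lemma cdiff_cauchy_integral (f : C -> C) (s0 s1 t0 t1 s t : R) :
  inner s0 s1 t0 t1 s t -> diff_bdry f s0 s1 t0 t1 ->
  cdiff (fun z => bint (fun x => f x / (x - z)) s0 s1 t0 t1) (pt s t).
Proof.
intros Hin Hf; set (a := pt s t).
assert (Hf' : forall s' t', bdry s0 s1 t0 t1 s' t' -> cdiff f (pt s' t')) by exact Hf.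
assert (Hs : (s0 <= s1)%R) by (destruct Hin; lra).
assert (Ht : (t0 <= t1)%R) by (destruct Hin; lra).
destruct (inner_dist_bdry _ _ _ _ _ _ Hin) as [r [Hr Hdist]]; fold a in Hdist.
destruct (bounded_bdry f s0 s1 t0 t1 Hf) as [M [PM HM]].
assert (PL : (0 <= L)%R) by apply side_sum_ge_0.
set (W := (s1 - s0 + (t1 - t0))%R).
assert (PW : (0 <= W)%R) by (unfold W; lra).
(* On the boundary [x - a] has modulus at least [r] and [x - z] at least [r / 2], so the remainder
   integrand is at most [2 * M / r ^ 3]. *)
set (B := (2 * L * (2 * M / r ^ 3) * W)%R).
assert (Pr : (0 < r ^ 3)%R) by (apply pow_lt; auto).
assert (PB : (0 <= B)%R).
{ unfold B; apply Rmult_le_pos; auto; apply Rmult_le_pos; [lra|].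
  apply Rdiv_le_0_compat; lra. }
assert (Hnz : forall z, (Cmod (z - a) < r)%R -> forall s' t', bdry s0 s1 t0 t1 s' t' ->
  pt s' t' - z <> 0).
{ intros z Hz s' t' Hb E; specialize (Hdist s' t' Hb).
  replace (pt s' t' - a) with ((pt s' t' - z) + (z - a)) in Hdist by ring.
  rewrite E, Cplus_0_l in Hdist; lra. }
assert (Ha : (Cmod (a - a) < r)%R).
{ replace (a - a) with (RtoC 0) by ring; rewrite Cmod_0; auto. }
exists (bint (fun x => f x / ((x - a) * (x - a))) s0 s1 t0 t1); intros e He.
exists (Rmin (r / 2) (e / (B + 1))); split.
{ apply Rmin_pos; [lra|apply Rdiv_lt_0_compat; lra]. }
intros z Hz; apply Rmin_Rgt in Hz as [Hz1 Hz2].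
assert (Hzr : (Cmod (z - a) < r)%R) by lra.
assert (D1 : forall y, (Cmod (y - a) < r)%R -> diff_bdry (fun x => f x / (x - y)) s0 s1 t0 t1).
{ intros y Hy s' t' Hb; apply cdiff_div; [auto|apply cdiff_sub_const|apply Hnz; auto]. }
assert (D2 : diff_bdry (fun x => f x / ((x - a) * (x - a))) s0 s1 t0 t1).
{ intros s' t' Hb; apply cdiff_div; [auto|apply cdiff_mult; apply cdiff_sub_const|].
  apply Cmult_neq_0; apply Hnz; auto. }
assert (D3 : diff_bdry (fun x => f x / ((x - z) * ((x - a) * (x - a)))) s0 s1 t0 t1).
{ intros s' t' Hb; apply cdiff_div; [auto| |].
  - apply cdiff_mult; [|apply cdiff_mult]; apply cdiff_sub_const.
  - repeat apply Cmult_neq_0; apply Hnz; auto. }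
assert (Dscal : forall c g, diff_bdry g s0 s1 t0 t1 -> diff_bdry (fun x => c * g x) s0 s1 t0 t1).
{ intros c g Hg s' t' Hb; apply cdiff_scal, Hg, Hb. }
set (R3 := bint (fun x => f x / ((x - z) * ((x - a) * (x - a)))) s0 s1 t0 t1).
assert (E : bint (fun x => f x / (x - z)) s0 s1 t0 t1 =
  bint (fun x => f x / (x - a)) s0 s1 t0 t1 +
  ((z - a) * bint (fun x => f x / ((x - a) * (x - a))) s0 s1 t0 t1 + (z - a) * (z - a) * R3)).
{ unfold R3; rewrite <- !bint_scal by auto.
  rewrite <- bint_plus by auto.
  rewrite <- bint_plus; auto; [|intros s' t' Hb; apply cdiff_plus; apply Dscal; auto].
  apply bint_ext; auto; intros s' t' Hb; field; split; apply Hnz; auto. }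
rewrite E.
replace (_ - _ - _) with ((z - a) * (z - a) * R3) by ring.
rewrite !Cmod_mult; set (x := Cmod (z - a)) in *.
assert (Px : (0 <= x)%R) by apply Cmod_ge_0.
assert (HR : (Cmod R3 <= B)%R).
{ unfold R3, B; apply bint_bound; auto; intros s' t' Hb.
  specialize (Hdist s' t' Hb); specialize (HM s' t' Hb).
  set (p := pt s' t') in *.
  assert (N1 : p - z <> 0) by (apply Hnz; auto).
  assert (N2 : p - a <> 0) by (apply Hnz; auto).
  assert (Hpz : (r / 2 <= Cmod (p - z))%R).
  { assert (Ht3 := Cmod_triangle_sub p z a); fold x in Ht3; lra. }
  rewrite Cmod_div, !Cmod_mult by (repeat apply Cmult_neq_0; auto).
  replace (2 * M / r ^ 3)%R with (M * / (r / 2 * (r * r)))%R by (field; lra).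
  apply Rmult_le_compat; auto using Cmod_ge_0.
  - left; apply Rinv_0_lt_compat; repeat apply Rmult_lt_0_compat; lra.
  - apply Rinv_le_contravar; [repeat apply Rmult_lt_0_compat; lra|].
    apply Rmult_le_compat; try lra; [nra|]; apply Rmult_le_compat; lra. }
assert (Hx2 : (x * (B + 1) <= e)%R).
{ replace e with (e / (B + 1) * (B + 1))%R at 1 by (field; lra).
  apply Rmult_le_compat_r; lra. }
pose proof (Cmod_ge_0 R3).
apply Rle_trans with (x * x * (B + 1))%R; nra.
Qed.

(** The quotient [(h x - h a) / (x - a)] is bounded near [a] because [h] is differentiable there, so
    its integral vanishes; what remains is [h a] times the integral of [/ (x - a)]. *)
Lemma cauchy_formula (h : C -> C) (s0 s1 t0 t1 s t : R) : inner s0 s1 t0 t1 s t ->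
  (forall s' t', (s0 <= s' <= s1)%R -> (t0 <= t' <= t1)%R -> cdiff h (pt s' t')) ->
  bint (fun x => h x / (x - pt s t)) s0 s1 t0 t1 = h (pt s t) * wind.
Proof.
intros Hin Hh; set (a := pt s t).
assert (Hs : (s0 <= s1)%R) by (destruct Hin; lra).
assert (Ht : (t0 <= t1)%R) by (destruct Hin; lra).
assert (Hdiv : forall f z, cdiff f z -> z <> a -> cdiff (fun x => f x / (x - a)) z).
{ intros f z Hf Hz; apply cdiff_div; [auto|apply cdiff_sub_const|now apply Csub_neq_0]. }
assert (Hhs : forall z, cdiff h z -> cdiff (fun x => h x - h a) z).
{ intros z Hz; apply cdiff_minus; auto; apply cdiff_const. }
assert (HN : forall s' t', bdry s0 s1 t0 t1 s' t' -> pt s' t' <> a).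
{ intros s' t' Hb; apply (inner_neq_bdry _ _ _ _ _ _ _ _ Hin Hb). }
assert (HB : forall s' t', bdry s0 s1 t0 t1 s' t' -> cdiff h (pt s' t')).
{ intros s' t' (? & ? & _); auto. }
destruct (Hh s t) as [A HA]; [destruct Hin; lra|destruct Hin; lra|].
destruct (cderiv_lip _ _ _ HA) as [d [Hd Hlip]]; fold a in Hlip.
assert (E0 : bint (fun x => (h x - h a) / (x - a)) s0 s1 t0 t1 = 0).
{ apply (goursat_removable _ s0 s1 t0 t1 s t (Cmod A + 1) d); auto.
  - intros s' t' Hs' Ht' Hne; apply (Hdiv (fun x => h x - h a)); auto.
    apply (pt_neq); auto.
  - intros z Hz Hzd; fold a in Hz, Hzd.
    assert (Pz := Cmod_sub_gt_0 _ _ Hz).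
    rewrite Cmod_div by (now apply Csub_neq_0).
    apply Rmult_le_reg_r with (1 := Pz); unfold Rdiv.
    rewrite Rmult_assoc, Rinv_l, Rmult_1_r by lra; auto. }
rewrite <- (bint_inv _ _ _ _ _ _ Hin); fold a.
rewrite <- bint_scal; auto.
2:{ intros s' t' Hb; apply cdiff_ext with (fun x => 1 / (x - a)).
    - intros; unfold Cdiv; ring.
    - apply (Hdiv (fun _ => 1)); auto; apply cdiff_const. }
rewrite <- (Cplus_0_l (bint (fun x => h a * / (x - a)) s0 s1 t0 t1)), <- E0.
rewrite <- bint_plus; auto.
- apply bint_ext; auto; intros s' t' Hb; field; apply Csub_neq_0; auto.
- intros s' t' Hb; apply (Hdiv (fun x => h x - h a)); auto.
- intros s' t' Hb; apply (Hdiv (fun _ => h a)); auto; apply cdiff_const.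
Qed.

(* By Cauchy's formula the difference quotient of [h] at [a] is a Cauchy
   integral, hence it extends to a function differentiable at [a] too. *)
Lemma cdiff_near_factor (h : C -> C) (a : C) : cdiff_near h a ->
  exists (h1 : C -> C) (d : R), (0 < d)%R /\ cdiff_near h1 a /\
    forall z, (Cmod (z - a) < d)%R -> h z = h a + (z - a) * h1 z.
Proof.
intros [d [Hd Hh]].
assert (PL : (0 <= L)%R) by apply side_sum_ge_0.
destruct (coord_lip) as [k [Hk Hlip]].
set (s := coord1 a); set (t := coord2 a).
assert (Ea : pt s t = a) by (apply pt_coord; auto).
set (r := (d / (2 * (L + 1)))%R).
assert (Hr : (0 < r)%R) by (apply Rdiv_lt_0_compat; lra).
assert (HQ : forall s' t', (s - r <= s' <= s + r)%R -> (t - r <= t' <= t + r)%R ->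
  cdiff h (pt s' t')).
{ intros s' t' Hs' Ht'; apply Hh; rewrite <- Ea.
  eapply Rle_lt_trans; [apply pt_lip|]; fold L.
  assert (Rabs (s' - s) <= r)%R by (apply Rabs_le; lra).
  assert (Rabs (t' - t) <= r)%R by (apply Rabs_le; lra).
  apply Rle_lt_trans with (L * (2 * r))%R; [apply Rmult_le_compat_l; lra|].
  replace d with (2 * (L + 1) * r)%R by (unfold r; field; lra); nra. }
assert (Hin : inner (s - r) (s + r) (t - r) (t + r) s t) by (split; lra).
(* By the Lipschitz bound on coordinates, this disc lies in the interior of the parallelogram on
   which Cauchy's formula is used. *)
assert (Hnear : forall z, (Cmod (z - a) < r / k)%R -> exists s' t',
  z = pt s' t' /\ inner (s - r) (s + r) (t - r) (t + r) s' t').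
{ intros z Hz; exists (coord1 z), (coord2 z); rewrite pt_coord by auto.
  split; auto.
  destruct (Hlip (coord1 z) (coord2 z) s t) as [H1 H2].
  rewrite pt_coord, Ea in H1, H2 by auto.
  assert (Hkz : (k * Cmod (z - a) < r)%R).
  { apply Rmult_lt_compat_l with (r := k) in Hz; auto.
    replace (k * (r / k))%R with r in Hz by (field; lra); auto. }
  apply Rle_lt_trans with (2 := Hkz) in H1; apply Rle_lt_trans with (2 := Hkz) in H2.
  apply Rabs_def2 in H1; apply Rabs_def2 in H2; split; lra. }
assert (Hw := wind_neq_0).
assert (HN : forall s' t' s'' t'', inner (s - r) (s + r) (t - r) (t + r) s' t' ->
  bdry (s - r) (s + r) (t - r) (t + r) s'' t'' -> pt s'' t'' <> pt s' t').
{ intros; eapply inner_neq_bdry; eauto. }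
assert (HB : diff_bdry h (s - r) (s + r) (t - r) (t + r)).
{ intros s' t' (? & ? & _); auto. }
assert (Hdiv : forall f s' t', inner (s - r) (s + r) (t - r) (t + r) s' t' ->
  diff_bdry f (s - r) (s + r) (t - r) (t + r) ->
  diff_bdry (fun x => f x / (x - pt s' t')) (s - r) (s + r) (t - r) (t + r)).
{ intros f s' t' Hi Hf s'' t'' Hb.
  apply cdiff_div; [apply Hf, Hb|apply cdiff_sub_const|apply Csub_neq_0; eauto]. }
set (h1 := fun z => / wind *
  bint (fun x => h x / (x - a) / (x - z)) (s - r) (s + r) (t - r) (t + r)).
assert (Hrk : (0 < r / k)%R) by (apply Rdiv_lt_0_compat; auto).
exists h1, (r / k)%R; split; [auto|split].
- exists (r / k)%R; split; auto.
  intros z Hz; destruct (Hnear z Hz) as (s' & t' & -> & Hi).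
  apply cdiff_scal, cdiff_cauchy_integral; auto.
  rewrite <- Ea; apply Hdiv; auto.
- intros z Hz; destruct (Hnear z Hz) as (s' & t' & -> & Hi).
  assert (C1 := cauchy_formula h _ _ _ _ _ _ Hin HQ).
  assert (C2 := cauchy_formula h _ _ _ _ _ _ Hi HQ).
  (* Partial fractions: 1/(x-z) - 1/(x-a) = (z-a)/((x-a)(x-z)). Cauchy's formula at [z] and at [a]
     turns this into [h z - h a], up to the factor [wind]. *)
  assert (E : bint (fun x => h x / (x - pt s' t')) (s - r) (s + r) (t - r) (t + r) =
    bint (fun x => h x / (x - pt s t)) (s - r) (s + r) (t - r) (t + r) +
    (pt s' t' - a) * bint (fun x => h x / (x - a) / (x - pt s' t')) (s - r) (s + r) (t - r) (t + r)).
  { rewrite <- Ea, <- bint_scal by (try lra; apply (Hdiv (fun x => h x / (x - pt s t))); auto).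
    rewrite <- bint_plus; auto; try lra.
    - apply bint_ext; try lra; intros s'' t'' Hb.
      field; split; apply Csub_neq_0; eauto.
    - intros s'' t'' Hb; apply cdiff_scal.
      apply (Hdiv (fun x => h x / (x - pt s t))); auto. }
  rewrite C1, C2, Ea in E.
  unfold h1; set (I := bint _ _ _ _ _) in *.
  replace (h (pt s' t')) with (h (pt s' t') * wind * / wind) by (field; auto).
  rewrite E; field; auto.
Qed.

(** One factorisation splits off the term of highest order, with coefficient [h a], and leaves [h1]
    over a power lower by one, to which the induction applies. Index [k] stands for exponent
    [k + 1], so [h a] is stored at index [S n] in the step. *)
Lemma principal_part_exists (n : nat) (h : C -> C) (a : C) : cdiff_near h a ->
  exists (c : nat -> C) (g : C -> C) (d : R), (0 < d)%R /\ cdiff_near g a /\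
    forall z, z <> a -> (Cmod (z - a) < d)%R ->
      h z / (z - a) ^ S n = sum_n (fun k => c k / (z - a) ^ S k) n + g z.
Proof.
revert h; induction n as [|n IH]; intros h Hh;
destruct (cdiff_near_factor h a Hh) as (h1 & d1 & Hd1 & Hh1 & E1).
- exists (fun _ => h a), h1, d1; repeat split; auto; intros z Hz Hzd.
  rewrite sum_O, (E1 z Hzd); simpl; field; now apply Csub_neq_0.
- destruct (IH h1 Hh1) as (c & g & d2 & Hd2 & Hg & E2).
  exists (fun k => if Nat.eq_dec k (S n) then h a else c k), g, (Rmin d1 d2).
  split; [now apply Rmin_pos|split; auto].
  intros z Hz Hzd; apply Rmin_Rgt in Hzd as [Hz1 Hz2].
  assert (Hza := Csub_neq_0 _ _ Hz).
  rewrite sum_Sn; destruct (Nat.eq_dec (S n) (S n)) as [_|F]; [|now destruct F].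
  rewrite (sum_n_ext_loc _ (fun k => c k / (z - a) ^ S k)).
  2:{ intros k Hkn; destruct (Nat.eq_dec k (S n)); [lia|auto]. }
  specialize (E2 z Hz Hz2); rewrite (E1 z Hz1).
  replace ((h a + (z - a) * h1 z) / (z - a) ^ S (S n))
    with (h a / (z - a) ^ S (S n) + h1 z / (z - a) ^ S n).
  2:{ rewrite (Cpow_S _ (S n)); field; split; auto; now apply Cpow_nz. }
  rewrite E2; unfold plus; simpl; ring.
Qed.

(** * Residue theorem and uniqueness of residues *)

Lemma bint_principal (c : nat -> C) (n : nat) (s0 s1 t0 t1 s t : R) : inner s0 s1 t0 t1 s t ->
  bint (principal c (pt s t) n) s0 s1 t0 t1 = wind * c 0%nat.
Proof.
intros Hin; set (a := pt s t).
assert (Hs : (s0 <= s1)%R) by (destruct Hin; lra).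
assert (Ht : (t0 <= t1)%R) by (destruct Hin; lra).
assert (HN : forall s' t', bdry s0 s1 t0 t1 s' t' -> pt s' t' <> a).
{ intros s' t' Hb; apply (inner_neq_bdry _ _ _ _ _ _ _ _ Hin Hb). }
assert (Hd : forall k, diff_bdry (fun z => / (z - a) ^ k) s0 s1 t0 t1).
{ intros k s' t' Hb; apply cdiff_inv_pow; auto. }
induction n as [|n IH].
- rewrite (bint_ext _ (fun z => c O * / (z - a) ^ 1)); auto.
  2:{ intros; unfold principal; now rewrite sum_O. }
  rewrite (bint_scal (c O) (fun z => / (z - a) ^ 1)) by auto.
  rewrite (bint_ext _ (fun z => / (z - a))); auto.
  2:{ intros; now rewrite Cpow_1_r. }
  unfold a; rewrite bint_inv by auto; ring.
- rewrite (bint_ext _ (fun z => principal c a n z + c (S n) * / (z - a) ^ S (S n))); auto.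
  2:{ intros; unfold principal; now rewrite sum_Sn. }
  rewrite (bint_plus (principal c a n) (fun z => c (S n) * / (z - a) ^ S (S n)));
    auto; [|intros s' t' Hb; apply cdiff_principal; auto
           |intros s' t' Hb; apply cdiff_scal, (Hd (S (S n))), Hb].
  rewrite (bint_scal (c (S n)) (fun z => / (z - a) ^ S (S n))) by auto.
  unfold a in *; rewrite IH, bint_inv_pow by auto; ring.
Qed.

(** Subtracting the principal part at the first pole removes that pole and keeps the residues at the
    others, where this principal part is holomorphic. The function changes at each step, so [f] is
    quantified inside the induction. As [res] is any admissible choice of residues, the result can
    be used to prove their uniqueness. *)
Lemma residue_sum (s0 s1 t0 t1 : R) (l : list C) (res : C -> C) :
  (s0 <= s1)%R -> (t0 <= t1)%R -> NoDup l -> forall f : C -> C,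
  (forall a, In a l -> (exists s t, a = pt s t /\ inner s0 s1 t0 t1 s t) /\
     residue_at f a (res a)) ->
  (forall s t, (s0 <= s <= s1)%R -> (t0 <= t <= t1)%R -> ~ In (pt s t) l -> cdiff f (pt s t)) ->
  bint f s0 s1 t0 t1 = wind * Csum (map res l).
Proof.
intros Hs Ht; induction l as [|a l IH]; intros HND f Hl Hf.
- simpl; rewrite goursat; auto; ring.
- apply NoDup_cons_iff in HND as [Hal HND].
  destruct (Hl a (or_introl eq_refl)) as [(s & t & Ea & Hin) (n & c & g & d & Hd & Hg & E & Er)].
  (* The value of [f] at [a] is arbitrary, so the difference is redefined there by the holomorphic
     part [g]. *)
  set (f1 := fun z => if Ceq_dec z a then g z else f z - principal c a n z).
  assert (Hf1 : forall z, z <> a -> f1 z = f z - principal c a n z).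
  { intros z Hz; unfold f1; destruct (Ceq_dec z a); tauto. }
  assert (Hloc : forall b, b <> a -> forall z, (Cmod (z - b) < Cmod (b - a))%R -> z <> a).
  { intros b Hb z Hz ->; rewrite Cmod_sub_sym in Hz; lra. }
  assert (HN : forall s' t', bdry s0 s1 t0 t1 s' t' -> pt s' t' <> a).
  { intros s' t' Hb; rewrite Ea; apply (inner_neq_bdry _ _ _ _ _ _ _ _ Hin Hb). }
  assert (Hf1d : forall s' t', (s0 <= s' <= s1)%R -> (t0 <= t' <= t1)%R ->
    ~ In (pt s' t') l -> cdiff f1 (pt s' t')).
  { intros s' t' Hs' Ht' Hnl; destruct (Ceq_dec (pt s' t') a) as [Eq|Ne].
    - rewrite Eq; apply cdiff_ext_loc with g d; auto; [|now apply cdiff_near_cdiff].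
      intros z Hz; unfold f1; destruct (Ceq_dec z a) as [|Hza]; auto.
      rewrite E by auto; ring.
    - apply cdiff_ext_loc with (fun z => f z - principal c a n z) (Cmod (pt s' t' - a)).
      + now apply Cmod_sub_gt_0.
      + intros z Hz; symmetry; apply Hf1; eauto.
      + apply cdiff_minus; [|now apply cdiff_principal].
        apply Hf; auto; intros [Eq|Hi]; auto. }
  assert (IHf := IH HND f1).
  assert (Hp : diff_bdry (principal c a n) s0 s1 t0 t1).
  { intros s' t' Hb; apply cdiff_principal; auto. }
  rewrite (bint_ext f (fun z => f1 z + principal c a n z)); auto.
  2:{ intros s' t' Hb; rewrite Hf1 by auto; ring. }
  rewrite (bint_plus f1 (principal c a n)); auto.
  2:{ intros s' t' Hb; destruct Hb as (B1 & B2 & B3); apply Hf1d; auto; intros Hi.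
      destruct (Hl (pt s' t') (or_intror Hi)) as [(s'' & t'' & Es & Hin') _].
      apply (inner_neq_bdry _ _ _ _ _ _ s' t' Hin'); unfold bdry; auto. }
  rewrite IHf; auto.
  + rewrite Ea, bint_principal by auto; rewrite <- Ea; simpl; rewrite Er; ring.
  + intros b Hb; destruct (Hl b (or_intror Hb)) as [Hbin (n' & c' & g' & d' & Hd' & Hg' & E' & Er')].
    assert (Hba : b <> a) by (intros ->; auto).
    split; auto.
    exists n', c', (fun z => g' z - principal c a n z), (Rmin d' (Cmod (b - a))).
    split; [apply Rmin_pos; auto; now apply Cmod_sub_gt_0|].
    split; [now apply cdiff_near_minus_principal|split; auto].
    intros z Hz Hzd; apply Rmin_Rgt in Hzd as [Hz1 Hz2].
    rewrite Hf1 by eauto; rewrite E' by auto; ring.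
Qed.

(** Both values, multiplied by the nonzero [wind], equal the integral of [f] around one small
    parallelogram about [a]; coefficients of the two principal parts need not be compared. *)
Lemma residue_at_unique (f : C -> C) (a r r' : C) :
  residue_at f a r -> residue_at f a r' -> r = r'.
Proof.
intros H H'; destruct (residue_at_cdiff f a r H) as [d [Hd Hf]].
assert (PL : (0 <= L)%R) by apply side_sum_ge_0.
set (s := coord1 a); set (t := coord2 a).
assert (Ea : pt s t = a) by (apply pt_coord; auto).
set (q := (d / (2 * (L + 1)))%R).
assert (Hq : (0 < q)%R) by (apply Rdiv_lt_0_compat; lra).
assert (Hin : inner (s - q) (s + q) (t - q) (t + q) s t) by (split; lra).
assert (HQ : forall s' t', (s - q <= s' <= s + q)%R -> (t - q <= t' <= t + q)%R ->
  ~ In (pt s' t') (a :: nil) -> cdiff f (pt s' t')).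
{ intros s' t' Hs' Ht' Hn; apply Hf; [intros E; apply Hn; left; auto|].
  rewrite <- Ea; eapply Rle_lt_trans; [apply pt_lip|]; fold L.
  assert (Rabs (s' - s) <= q)%R by (apply Rabs_le; lra).
  assert (Rabs (t' - t) <= q)%R by (apply Rabs_le; lra).
  apply Rle_lt_trans with (L * (2 * q))%R; [apply Rmult_le_compat_l; lra|].
  replace d with (2 * (L + 1) * q)%R by (unfold q; field; lra); nra. }
assert (ND : NoDup (a :: nil)) by (repeat constructor; auto).
assert (R : forall x, residue_at f a x ->
  bint f (s - q) (s + q) (t - q) (t + q) = wind * x).
{ intros x Hx.
  rewrite (residue_sum (s - q) (s + q) (t - q) (t + q) (a :: nil) (fun _ => x)); auto; try lra.
  - simpl; ring.
  - intros b [<-|[]]; split; auto; exists s, t; auto. }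
assert (Hw := wind_neq_0).
assert (E : wind * r = wind * r') by (rewrite <- R, <- R; auto).
replace r with (/ wind * (wind * r)) by (field; auto); rewrite E; field; auto.
Qed.

Lemma residue_eq (f : C -> option C) (a r : C) : is_residue f a r -> residue f a = r.
Proof.
intros H; apply (iota_unique (V := C_CompleteNormedModule)); auto.
intros r' H'; apply (residue_at_unique (finite_value f) a);
  now apply is_residue_residue_at.
Qed.

Lemma pole_has_residue (f : C -> option C) (a : C) :
  pole_at f a -> exists r, is_residue f a r.
Proof.
intros (_ & m & h & Hm & Hh & _ & Hf).
destruct m as [|n]; [lia|].
apply locally_Cmod in Hh as [d [Hd Hh]]; apply locally'_Cmod in Hf as [d' [Hd' Hf]].
destruct (principal_part_exists n h a) as (c & g & e & He & [e' [He' Hg]] & E).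
{ exists d; split; auto; intros z Hz; apply cdiff_ex_derive, Hh, Hz. }
exists (c O), n, c, g; split; [|split; auto].
- apply locally_Cmod; exists e'; split; auto; intros z Hz; apply cdiff_ex_derive, Hg, Hz.
- apply locally'_Cmod; exists (Rmin e d'); split; [now apply Rmin_pos|].
  intros z Hz Hzd; apply Rmin_Rgt in Hzd as [Hz1 Hz2]; rewrite Hf, <- E; auto.
Qed.

(** * Poles and periods *)

(** Poles are isolated, so a small parallelogram about a point contains at most that one; bisection
    does the rest. Asking only that the list cover the poles lets the lists of the four quarters be
    concatenated. *)
Lemma finite_poles (f : C -> option C) (s0 s1 t0 t1 : R) : meromorphic f ->
  (s0 <= s1)%R -> (t0 <= t1)%R ->
  exists l : list C, forall s t, (s0 <= s <= s1)%R -> (t0 <= t <= t1)%R ->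
    f (pt s t) = None -> In (pt s t) l.
Proof.
intros Hm Hs Ht.
apply (rectangle_bisection (fun a b c d => exists l : list C, forall s t,
  (a <= s <= b)%R -> (c <= t <= d)%R -> f (pt s t) = None -> In (pt s t) l)); auto.
- intros a b c d m n _ _ _ _ _ _ [l1 H1] [l2 H2] [l3 H3] [l4 H4].
  exists (l1 ++ l2 ++ l3 ++ l4); intros s t Hs' Ht' Hf; rewrite !in_app_iff.
  destruct (Rle_dec s m), (Rle_dec t n).
  + left; apply H1; auto; lra.
  + right; right; left; apply H3; auto; lra.
  + right; left; apply H2; auto; lra.
  + right; right; right; apply H4; auto; lra.
- intros s t _ _.
  destruct (meromorphic_poles_isolated f (pt s t) Hm) as [d [Hd H]].
  assert (PL : (0 <= L)%R) by apply side_sum_ge_0.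
  exists (d / (2 * (L + 1)))%R; split; [apply Rdiv_lt_0_compat; lra|].
  set (e := (d / (2 * (L + 1)))%R).
  assert (Hde : d = (2 * (L + 1) * e)%R) by (unfold e; field; lra).
  intros a b c k _ Has _ _ Hct _ Hba Hkc; exists (pt s t :: nil).
  intros s' t' Hs' Ht' Hf; left.
  destruct (Ceq_dec (pt s' t') (pt s t)) as [E|E]; auto.
  exfalso; apply (H _ E); auto.
  eapply Rle_lt_trans; [apply pt_lip|]; fold L.
  assert (Rabs (s' - s) <= e)%R by (apply Rabs_le; lra).
  assert (Rabs (t' - t) <= e)%R by (apply Rabs_le; lra).
  assert (0 < e)%R by (unfold e; apply Rdiv_lt_0_compat; lra).
  apply Rle_lt_trans with (L * (2 * e))%R; [apply Rmult_le_compat_l; lra|nra].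
Qed.

Lemma bint_periodic_eq_0 (g : C -> C) (s t : R) :
  (forall z, g (z + w1) = g z /\ g (z + w2) = g z) ->
  bint g s (s + 1) t (t + 1) = 0.
Proof.
intros Hp; unfold bint.
rewrite (CInt_ext (fun x => g (pt x (t + 1))) (fun x => g (pt x t))); [|lra|].
2:{ intros x _; replace (pt x (t + 1)) with (pt x t + w2); [apply Hp|].
    unfold pt; rewrite RtoC_plus; ring. }
rewrite (CInt_ext (fun x => g (pt (s + 1) x)) (fun x => g (pt s x))); [|lra|].
2:{ intros x _; replace (pt (s + 1) x) with (pt s x + w1); [apply Hp|].
    unfold pt; rewrite RtoC_plus; ring. }
ring.
Qed.

End Parallelogram.

Lemma ratio_not_real (w1 w2 : C) : (forall r : R, w1 / w2 <> RtoC r) ->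
  (Re w1 * Im w2 - Im w1 * Re w2 <> 0)%R.
Proof.
intros H E; destruct (Ceq_dec w2 0) as [->|Hw].
(* With [w2 = 0] the quotient is 0 by the convention for the inverse, hence real. *)
- apply (H 0%R); unfold Cdiv, Cinv, Cmult; destruct w1; simpl.
  unfold RtoC; f_equal; unfold Rdiv; ring.
- assert (Hi : Im (w1 / w2) = 0%R).
  { unfold Cdiv; rewrite Im_mult_inv by auto.
    replace (Im w1 * Re w2 - Re w1 * Im w2)%R with 0%R by lra; unfold Rdiv; ring. }
  apply (H (Re (w1 / w2))); destruct (w1 / w2) as [x y]; unfold Re, Im in *; simpl in *.
  unfold RtoC; now rewrite Hi.
Qed.

Theorem proposition3 :
  forall (w1 w2 : C) (f : C -> option C),
    (forall r : R, w1 / w2 <> RtoC r) ->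
    elliptic w1 w2 f ->
    exists poles : list C,
      NoDup poles /\
      (forall z : C,
         In z poles <-> fundamental_parallelogram w1 w2 z /\ pole_at f z) /\
      Csum (map (residue f) poles) = 0.
Proof.
intros w1 w2 f Hw [Hm Hper]; apply ratio_not_real in Hw as HD.
set (s_ := coord1 w1 w2); set (t_ := coord2 w1 w2); set (p := pt w1 w2).
assert (ps : forall s t, s_ (p s t) = s) by (intros; apply coord1_pt; auto).
assert (pt' : forall s t, t_ (p s t) = t) by (intros; apply coord2_pt; auto).
assert (pst : forall z, p (s_ z) (t_ z) = z) by (intros; apply pt_coord; auto).
destruct (finite_poles w1 w2 f 0 1 0 1 Hm) as [l0 Hl0]; try lra.
destruct (list_comprehension (fun z => fundamental_parallelogram w1 w2 z /\ pole_at f z) l0)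
  as [l [HND Hl]].
assert (Hin : forall z, In z l <-> fundamental_parallelogram w1 w2 z /\ pole_at f z).
{ intros z; rewrite Hl; split; [tauto|]; intros Hz; split; auto.
  destruct Hz as [(s & t & Hs & Ht & ->) [Hz _]]; apply Hl0; auto; lra. }
assert (Hco : forall z, In z l -> (0 <= s_ z < 1)%R /\ (0 <= t_ z < 1)%R).
{ intros z Hz; apply Hin in Hz as [(s & t & Hs & Ht & ->) _].
  change (RtoC s * w1 + RtoC t * w2) with (p s t); rewrite ps, pt'; auto. }
exists l; split; [auto|split; auto].
(* The corner of the translated parallelogram shares neither coordinate with a pole of the list, so
   no translated pole falls on its boundary. *)
destruct (exists_avoiding (map s_ l) 0 1 Rlt_0_1) as [sg [Hsg Hsl]].
destruct (exists_avoiding (map t_ l) 0 1 Rlt_0_1) as [ta [Hta Htl]].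
assert (Hs_ : forall z, In z l -> s_ z <> sg) by (intros z Hz <-; now apply Hsl, in_map).
assert (Ht_ : forall z, In z l -> t_ z <> ta) by (intros z Hz <-; now apply Htl, in_map).
(* Adding [up c x] carries [0, 1) bijectively onto [c, c + 1); [sh] does this in both coordinates
   and so moves a point by a period. *)
set (up := fun c x : R => if Rlt_dec x c then 1%R else 0%R).
set (sh := fun z => p (s_ z + up sg (s_ z))%R (t_ z + up ta (t_ z))%R).
assert (Hup : forall c x, (up c x = 1%R /\ (x < c)%R) \/ (up c x = 0%R /\ (c <= x)%R)).
{ intros c x; unfold up; destruct (Rlt_dec x c); [left|right]; split; auto; lra. }
assert (Hres : forall z, In z l -> exists r, is_residue f z r /\ is_residue f (sh z) r).
{ intros z Hz; apply Hin in Hz as [_ Hz].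
  destruct (pole_has_residue w1 w2 HD f z Hz) as [r Hr]; exists r; split; auto.
  assert (T : forall w c x, (forall y, f (y + w) = f y) ->
    forall y, is_residue f y r -> is_residue f (y + RtoC (up c x) * w) r).
  { intros w c x Hpw y Hy; destruct (Hup c x) as [[-> _]|[-> _]].
    - rewrite Cmult_1_l; now apply is_residue_translate.
    - now rewrite Cmult_0_l, Cplus_0_r. }
  replace (sh z) with (z + RtoC (up sg (s_ z)) * w1 + RtoC (up ta (t_ z)) * w2).
  - apply T; [apply Hper|]; apply T; [apply Hper|auto].
  - unfold sh; rewrite <- (pst z) at 1; unfold p, pt; rewrite !RtoC_plus; ring. }
assert (Hsh : forall z, In z l -> residue f (sh z) = residue f z).
{ intros z Hz; destruct (Hres z Hz) as (r & H1 & H2).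
  now rewrite (residue_eq w1 w2 HD f _ r H1), (residue_eq w1 w2 HD f _ r H2). }
(* Original coordinates lie in [0, 1) and change by 0 or 1, so distinct poles stay distinct. *)
assert (ND' : NoDup (map sh l)).
{ apply NoDup_map_NoDup_ForallPairs; auto; intros x y Hx Hy E.
  assert (E1 := f_equal s_ E); assert (E2 := f_equal t_ E).
  unfold sh in E1, E2; rewrite !ps in E1; rewrite !pt' in E2.
  destruct (Hco x Hx), (Hco y Hy).
  rewrite <- (pst x), <- (pst y); f_equal;
  [destruct (Hup sg (s_ x)) as [[U V]|[U V]], (Hup sg (s_ y)) as [[U' V']|[U' V']]
  |destruct (Hup ta (t_ x)) as [[U V]|[U V]], (Hup ta (t_ y)) as [[U' V']|[U' V']]]; lra. }
assert (Hsum := residue_sum w1 w2 HD sg (sg + 1) ta (ta + 1) (map sh l) (residue f)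
  ltac:(lra) ltac:(lra) ND' (finite_value f)).
rewrite bint_periodic_eq_0 in Hsum.
2:{ intros z; unfold finite_value; destruct (Hper z) as [-> ->]; auto. }
rewrite map_map, (map_ext_in (fun z => residue f (sh z)) (residue f)) in Hsum by exact Hsh.
assert (Hwi := wind_neq_0 w1 w2 HD).
replace (Csum (map (residue f) l))
  with (/ wind w1 w2 * (wind w1 w2 * Csum (map (residue f) l))) by (field; auto).
rewrite <- Hsum; [ring| |].
- intros a Ha; apply in_map_iff in Ha as (z & <- & Hz).
  destruct (Hco z Hz); specialize (Hs_ z Hz); specialize (Ht_ z Hz); split.
  + exists (s_ z + up sg (s_ z))%R, (t_ z + up ta (t_ z))%R; split; auto.
    split; [destruct (Hup sg (s_ z)) as [[U V]|[U V]]|destruct (Hup ta (t_ z)) as [[U V]|[U V]]];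
    rewrite U; lra.
  + destruct (Hres z Hz) as (r & _ & H2).
    rewrite (residue_eq w1 w2 HD f _ r H2); now apply is_residue_residue_at.
- intros s t Hs Ht Hn; apply meromorphic_cdiff; auto; intros Hf; apply Hn.
  (* The closed interval contains both [c] and [c + 1], which reduce to the same [y = c], whereas
     [up c] yields only the first. Hence the proviso [y <> c], met below because [sg] and [ta] avoid
     the coordinates of the poles. *)
  assert (Hred : forall c x, (0 < c < 1)%R -> (c <= x <= c + 1)%R ->
    exists y e, (0 <= y < 1)%R /\ (e = 0 \/ e = 1)%R /\ x = (y + e)%R /\
      (y <> c -> e = up c y)).
  { intros c x Hc Hx; destruct (Rlt_dec x 1).
    - exists x, 0%R; split; [lra|split; [auto|split; [ring|intros Ne]]].
      destruct (Hup c x) as [[U V]|[U V]]; lra.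
    - exists (x - 1)%R, 1%R; split; [lra|split; [auto|split; [ring|intros Ne]]].
      destruct (Hup c (x - 1)%R) as [[U V]|[U V]]; lra. }
  destruct (Hred sg s Hsg Hs) as (s' & e1 & Hs' & He1 & -> & Hu1).
  destruct (Hred ta t Hta Ht) as (t' & e2 & Ht' & He2 & -> & Hu2).
  assert (Hf' : f (p s' t') = None).
  { rewrite <- Hf.
    replace (pt w1 w2 (s' + e1) (t' + e2)) with (p s' t' + RtoC e1 * w1 + RtoC e2 * w2)
      by (unfold p, pt; rewrite !RtoC_plus; ring).
    assert (T : forall w e, (forall y, f (y + w) = f y) -> (e = 0 \/ e = 1)%R ->
      forall y, f (y + RtoC e * w) = f y).
    { intros w e Hpw [-> | ->] y; [now rewrite Cmult_0_l, Cplus_0_r|now rewrite Cmult_1_l]. }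
    rewrite !T; auto; intros; apply Hper. }
  assert (Hil : In (p s' t') l).
  { apply Hin; split; [exists s', t'; auto|now apply meromorphic_None]. }
  apply in_map_iff; exists (p s' t'); split; auto.
  unfold sh; rewrite ps, pt', <- Hu1, <- Hu2; auto.
  + rewrite <- (pt' s' t'); auto.
  + rewrite <- (ps s' t'); auto.
Qed.
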